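(* Let $\beta>0$, $L>0$ and $0<\mathfrak{h}<1$ be constants, let $\eta\in(0,1)$, and let $(\sigma_n)_{n\ge1}$ be a sequence of nonnegative reals with $\sigma_n^4=o(n^{1-\eta})$. Then, as $n\to\infty$, $$R_\infty\left(\Sigma_{\mathfrak{h}}(\beta,L),\sigma_n\right)=\Theta_{\beta,L,\eta,\mathfrak{h}}\left(\left(\max(1,\sigma_n^4)\,\frac{\log n}{n}\right)^{\frac{\beta}{2\beta+1}}\right).$$
   Context: Function class: let $k$ be the largest integer strictly less than $\beta$. $\Sigma(\beta,L)$ is the set of $k$-times differentiable functions $f:[0,1]\to\mathbb{R}$ with $|f^{(k)}(x)-f^{(k)}(y)|\le L|x-y|^{\beta-k}$ for all $x,y\in[0,1]$, and $\Sigma_{\mathfrak{h}}(\beta,L)=\{f\in\Sigma(\beta,L):\mathfrak{h}\le f(x)\le 1 \text{ for all } x\in[0,1]\}$. Observation model (speckle plus additive noise): for an unknown $f$ one observes $Y_i=f(i/n)\xi_i+\tau_i$, $i=1,\dots,n$, where $\xi_1,\dots,\xi_n$ are i.i.d. $\mathcal{N}(0,1)$, $\tau_1,\dots,\tau_n$ are i.i.d. $\mathcal{N}(0,\sigma_n^2)$, and the $\xi_i$ and $\tau_i$ are all mutually independent. $\mathbb{E}_f$ denotes expectation under this model. Minimax risk: $R_\infty(\Sigma_{\mathfrak{h}}(\beta,L),\sigma_n)=\inf_{\hat\nu}\sup_{f\in\Sigma_{\mathfrak{h}}(\beta,L)}\mathbb{E}_f\|f-\hat\nu\|_\infty$, where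 the infimum is over all estimators $\hat\nu$ (measurable functions of $Y_1,\dots,Y_n$ with values in functions on $[0,1]$) and $\|g\|_\infty=\sup_{x\in[0,1]}|g(x)|$. Asymptotic notation: $a_n=O(b_n)$ means there are constants $C,M>0$ with $|a_n|\le C|b_n|$ for all $n>M$; $a_n=\Theta(b_n)$ means $a_n=O(b_n)$ and $b_n=O(a_n)$; $a_n=o(b_n)$ means $a_n/b_n\to0$. Subscripts on $\Theta$ indicate that the multiplicative constants $C$ depend only on the listed parameters (the threshold $M$ may depend on the sequences). *)

(* Defs.v *)
From mathcomp Require Import all_boot all_order all_algebra.
From mathcomp Require Import all_classical all_reals all_analysis.
From mathcomp Require Import measurable_realfun.
Set Implicit Arguments.
Unset Strict Implicit.
Unset Printing Implicit Defensive.
Import Order.TTheory GRing.Theory Num.Theory.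
Import numFieldNormedType.Exports.
Local Open Scope classical_set_scope.
Local Open Scope ring_scope.

(* A function on [0,1] is represented by a total function R -> R; nothing below
   depends on its values outside [0,1]. *)
Section function_class.
Context {R : realType}.
Implicit Types (beta L h : R) (f g : R -> R).

(* The limit of the difference quotient is taken inside [0,1]: the derivative
   is one-sided at the endpoints. *)
Definition has_derivative01 f g :=
  forall x : R, x \in `[0, 1] ->
    (f y - f x) / (y - x) @[y --> within `[0, 1] x^'] --> g x.

Definition smoothness_order beta : nat := `|Num.ceil beta - 1|%N.

Lemma smoothness_orderP beta : 0 < beta ->
  (smoothness_order beta)%:R < beta <= (smoothness_order beta).+1%:R.
Proof.
move=> b0; have c0 : (0 < Num.ceil beta)%R by rewrite ceil_gt0.
have kE : (smoothness_order beta)%:R = (Num.ceil beta - 1)%:~R :> R.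
  by rewrite /smoothness_order natr_absz ger0_norm// subr_ge0 -gtz0_ge1.
rewrite -natr1 kE intrB subrK ceil_ge andbT.
by have := ceilB1_lt beta; rewrite intrB.
Qed.

Definition holder_class beta L : set (R -> R) :=
  let k := smoothness_order beta in
  [set f | exists D : nat -> R -> R,
    [/\ D 0%N = f,
        forall j, (j < k)%N -> has_derivative01 (D j) (D j.+1) &
        forall x y : R, x \in `[0, 1] -> y \in `[0, 1] ->
          `|D k x - D k y| <= L * `|x - y| `^ (beta - k%:R)]].

Definition bounded_holder_class h beta L : set (R -> R) :=
  holder_class beta L `&`
  [set f | forall x : R, x \in `[0, 1] -> h <= f x <= 1].

Definition sup_norm01 g : \bar R :=
  ereal_sup [set `|g x|%:E | x in `[0, 1]].

End function_class.

Section noise.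
Context {R : realType}.

(* The library's [normal_prob m 0] is the uniform law on [0,1], not the
   degenerate Gaussian, hence the case distinction. *)
Definition gaussian_law (m s : R) (A : set R) : \bar R :=
  if s == 0 then \d_m A else normal_prob m s A.

Definition has_law d (T : measurableType d) (P : probability T R)
    (X : {RV P >-> R}) (mu : set R -> \bar R) :=
  forall A, measurable A -> distribution P X A = mu A.

Definition mutually_independent d (T : measurableType d) (P : probability T R)
    (I : finType) (X : I -> {RV P >-> R}) :=
  forall (J : {set I}) (B : I -> set R), (forall i, measurable (B i)) ->
    P (\bigcap_(i in [set` J]) (X i @^-1` B i)) =
    (\prod_(i in J) P (X i @^-1` B i))%E.

End noise.

Record noise_model (R : realType) (n : nat) (s : R) := NoiseModel {
  noise_display : measure_display;
  noise_space : measurableType noise_display;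
  noise_prob : probability noise_space R;
  speckle_noise : 'I_n -> {RV noise_prob >-> R};
  additive_noise : 'I_n -> {RV noise_prob >-> R};
  speckle_noise_law : forall i, has_law (speckle_noise i) (gaussian_law 0 1);
  additive_noise_law : forall i, has_law (additive_noise i) (gaussian_law 0 s);
  noise_independent : mutually_independent
    (fun j : 'I_n + 'I_n =>
       match j with
       | inl i => speckle_noise i
       | inr i => additive_noise i
       end)
}.

Section minimax.
Context {R : realType}.

(* Indices are shifted: [i : 'I_n] stands for i + 1 in {1, ..., n}. *)
Definition observation n s (N : @noise_model R n s) (f : R -> R)
    (w : noise_space N) : n.-tuple R :=
  [tuple f (i.+1%:R / n%:R) * speckle_noise N i w + additive_noise N i w
  | i < n].

(* Values in the functions on [0,1], with the cylinder sigma-algebra; as a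
   supremum over [0,1] need not be measurable, measurability of the loss is
   required as well, so that the risk is a genuine expectation. *)
Definition estimator (Sigma : set (R -> R)) n : set (n.-tuple R -> R -> R) :=
  [set nu : n.-tuple R -> R -> R |
    (forall x : R, x \in `[0, 1] ->
       measurable_fun [set: n.-tuple R] (fun y => nu y x)) /\
    (forall f : R -> R, Sigma f ->
       measurable_fun [set: n.-tuple R]
         (fun y => sup_norm01 (fun x => f x - nu y x)))].

Definition risk n s (N : @noise_model R n s) (nu : n.-tuple R -> R -> R)
    (f : R -> R) : \bar R :=
  (\int[noise_prob N]_w
     sup_norm01 (fun x => (f x - nu (observation f w) x)%R))%E.

Definition minimax_risk (Sigma : set (R -> R)) n s (N : @noise_model R n s) :
    \bar R :=
  ereal_inf [set ereal_sup [set risk N nu f | f in Sigma]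
            | nu in @estimator Sigma n].

Definition bigO_with (C : R) (a b : nat -> \bar R) :=
  exists M : nat, forall n, (M < n)%N -> (`|a n| <= C%:E * `|b n|)%E.

Definition Theta_with (C C' : R) (a b : nat -> \bar R) :=
  bigO_with C a b /\ bigO_with C' b a.

End minimax.

(* Main.v *)
Require Import Defs.
From HB Require Import structures.
From mathcomp Require Import all_boot all_order all_algebra.
From mathcomp Require Import all_classical all_reals all_analysis.
From mathcomp Require Import measurable_realfun ring lra zify.

(** The observations are independent centred Gaussian variables of variances
    [f(i/n)^2 + sigma^2], because a Gaussian sum is Gaussian
    ([gaussian_sum_law], [observation_law]).  The function is thus seen through
    the squares of the observations, whose fluctuations are of order
    [max 1 (sigma^2)].  Let [r = max 1 (sigma^4) * ln n / n] and
    [delta = r ^ (1 / (2 beta + 1))], so that the rate is [delta ^ beta] and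
    [n * delta * delta ^ (2 beta) = max 1 (sigma^4) * ln n]: on a window of
    [n * delta] points, a bias [delta ^ beta] and the logarithmically inflated
    noise of an average of squares are of the same order.

    Upper bound.  The value of [f^2] at a design point is estimated by a finite
    difference of order [2 k + 1] of the squares, averaged over about
    [n * delta] steps; [k] is the number of derivatives of [f].  The difference
    annihilates the square of the Taylor polynomial of [f], so that the bias is [O(delta ^ beta)]
    ([holder_square_difference]).  The square root is taken after truncation
    at [h^2], and the result is extended to [0,1] as a step function; a uniform
    modulus of continuity ([bounded_holder_modulus]) shows that this costs
    nothing.  Squares of Gaussian variables have exponential moments
    ([integral_normal_expR_centered]), which bounds the expected maximum of the
    noise over all design points ([norm_le_expR],
    [expectation_exponential_sum], [minimax_risk_upper]).

    Lower bound.  About [1 / delta] disjoint bumps of width [delta] and height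
    [kappa * delta ^ beta] are added, one at a time, to the constant [h]
    ([holder_bump]).  Likelihood ratios with respect to the constant
    ([change_of_measure]) of two distinct alternatives are uncorrelated, and
    each has second moment at most [n ^ (8 kappa^2 / h^4)]
    ([integral_likelihood_ratio_sqr]).  By the assumption on [sigma] the number
    of bumps is at least a power of [n] whose exponent depends on [beta] and
    [eta] only; for [kappa] small the average of the likelihood ratios
    therefore has a bounded second moment, and no estimator can tell the
    constant from the mixture of the alternatives ([mixture_lower_bound],
    [minimax_risk_lower]). *)

Set Implicit Arguments.
Unset Strict Implicit.
Unset Printing Implicit Defensive.
Import Order.TTheory GRing.Theory Num.Theory.
Import numFieldNormedType.Exports.
Import HBNNSimple.
Local Open Scope classical_set_scope.
Local Open Scope ring_scope.

(** * Measurability and monotonicity of finite products *)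

Section big_set.
Local Open Scope ereal_scope.

Lemma bigcap_ordD1 (T : Type) n (k : 'I_n) (E : 'I_n -> set T) :
  \bigcap_i E i = (\bigcap_(i in [set i | i != k]) E i) `&` E k.
Proof.
apply/seteqP; split=> [t Et|t [Et Ek] i _].
  by split; [move=> i _|]; exact: Et.
by have [->//|ik] := eqVneq i k; exact: Et.
Qed.

Lemma measurable_bigcap_ord d (T : measurableType d) n (Q : set 'I_n)
    (E : 'I_n -> set T) :
  (forall i, measurable (E i)) -> measurable (\bigcap_(i in Q) E i).
Proof. by move=> mE; apply: fin_bigcap_measurable => //; exact: finite_finset. Qed.

Lemma measurable_prode d (T : measurableType d) (R : realType) (I : Type)
    (r : seq I) (Q : pred I) (F : I -> T -> \bar R) :
  (forall i, measurable_fun setT (F i)) ->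
  measurable_fun setT (fun t => \prod_(i <- r | Q i) F i t).
Proof.
move=> mF; elim: r => [|i r IH].
  by under eq_fun do rewrite big_nil; exact: measurable_cst.
under eq_fun do rewrite big_cons.
case: (Q i) => //; exact: emeasurable_funM.
Qed.

Lemma lee_prod (R : realType) (I : Type) (r : seq I) (F G : I -> \bar R) :
  (forall i, 0 <= F i <= G i) -> (\prod_(i <- r) F i <= \prod_(i <- r) G i).
Proof.
move=> FG; suff [] : (0 <= \prod_(i <- r) F i /\ \prod_(i <- r) F i <= \prod_(i <- r) G i) by [].
elim/big_ind2 : _ => [|x1 x2 y1 y2 [x10 x12] [y10 y12]|i _].
- by rewrite lexx lee_fin ler01.
- by split; [exact: mule_ge0|exact: lee_pmul].
- by have /andP[] := FG i.
Qed.

End big_set.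

Lemma measurable_sum_pred d (T : measurableType d) (R : realType) (I : Type)
    (r : seq I) (Q : pred I) (F : I -> T -> R) :
  (forall i, measurable_fun setT (F i)) ->
  measurable_fun setT (fun t => \sum_(i <- r | Q i) F i t).
Proof.
move=> mF; under eq_fun do rewrite big_mkcond.
by apply: measurable_sum => i; case: (Q i).
Qed.


(** * Gaussian sums and Gaussian moments *)

Section weighted_law.
Local Open Scope ereal_scope.
Context d d' (T : measurableType d) (U : measurableType d') (R : realType).
Variables (P : {measure set T -> \bar R}) (mu : {measure set U -> \bar R}).
Variables (Y : T -> U) (H : T -> \bar R) (c : \bar R).
Hypotheses (mY : measurable_fun setT Y) (mH : measurable_fun setT H).
Hypotheses (H0 : forall t, 0 <= H t) (Hfin : forall t, H t \is a fin_num).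
Hypothesis cfin : c \is a fin_num.
Hypothesis law : forall B, measurable B ->
  \int[P]_(t in Y @^-1` B) H t = c * mu B.

Lemma weighted_law_indic (B : set U) : measurable B ->
  \int[P]_t (H t * (\1_B (Y t))%:E) = c * mu B.
Proof.
move=> mB; rewrite -law// [RHS]integral_mkcond; apply: eq_integral => t _.
rewrite patchE indicE; case: ifPn => [|] tB.
  by rewrite mem_set ?mule1//; rewrite inE in tB.
by rewrite memNset ?mule0//; rewrite notin_setE in tB.
Qed.

Let law_nnsfun (g : {nnsfun U >-> R}) :
  \int[P]_t (H t * (g (Y t))%:E) = c * \int[mu]_u (g u)%:E.
Proof.
have mg y : measurable (g @^-1` [set y]) by [].
transitivity (\sum_(y \in range g) (y%:E * (c * mu (g @^-1` [set y])))).
  transitivity (\int[P]_t (\sum_(y \in range g)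
      (y%:E * (H t * (\1_(g @^-1` [set y]) (Y t))%:E)))).
    apply: eq_integral => t _; rewrite {1}fimfunE -fsumEFin//.
    rewrite ge0_mule_fsumr//; last first.
      by move=> y; rewrite nnfun_muleindic_ge0.
    by apply: eq_fsbigr => y _; rewrite EFinM muleCA.
  have mt y : measurable_fun setT
      (fun t => H t * (\1_(g @^-1` [set y]) (Y t))%:E).
    apply: emeasurable_funM => //; apply/measurable_EFinP.
    by apply: measurableT_comp => //.
  rewrite ge0_integral_fsum//.
  - apply: eq_fsbigr => y yg; rewrite ge0_integralZl//.
    + by rewrite weighted_law_indic.
    + by move=> t _; rewrite mule_ge0// lee_fin.
    + by move: yg; rewrite inE => -[x _ <-]; rewrite lee_fin.
  - by move=> y; apply: measurable_funeM.
  - move=> y t _; rewrite muleCA mule_ge0// -EFinM; exact: nnfun_muleindic_ge0.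
under eq_integral do rewrite fimfunE -fsumEFin//.
rewrite ge0_integral_fsum//; first last.
- move=> y t _; exact: nnfun_muleindic_ge0.
- by move=> y; apply/measurable_EFinP; apply: measurable_funM.
rewrite ge0_mule_fsumr; last first.
  by move=> y; apply: integral_ge0 => t _; exact: nnfun_muleindic_ge0.
apply: eq_fsbigr => y yg.
rewrite (_ : \int[mu]_x _ = y%:E * mu (g @^-1` [set y])) 1?muleCA//.
rewrite -[X in _ * mu X]setIT -integral_indic// -ge0_integralZl//.
  by apply/measurable_EFinP.
by move: yg; rewrite inE => -[x _ <-]; rewrite lee_fin.
Qed.

(** A change of variables in which the weight [H] and the image variable [Y]
    need only be decoupled on indicators of [Y]: simple functions and monotone
    convergence do the rest.  Finiteness of [H] and [c] makes multiplication by
    them continuous on the extended reals.  Transfer of laws, densities and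
    the independence arguments below are all instances. *)
Lemma ge0_integral_weighted_law (g : U -> \bar R) :
  measurable_fun setT g -> (forall u, 0 <= g u) ->
  \int[P]_t (H t * g (Y t)) = c * \int[mu]_u g u.
Proof.
move=> mg g0.
pose a := nnsfun_approx measurableT mg.
have ag u : EFin \o a^~ u @ \oo --> g u.
  exact: (cvg_nnsfun_approx measurableT mg (fun x _ => g0 x)).
have ande u : {homo (fun n => (a n u)%:E) : n m / (n <= m)%N >-> n <= m}.
  by move=> n m nm; rewrite lee_fin; exact/lefP/nd_nnsfun_approx.
have h1 : \int[P]_t (H t * (a n (Y t))%:E) @[n --> \oo] -->
    \int[P]_t (H t * g (Y t)).
  have := @cvg_monotone_convergence _ _ _ P setT measurableT
      (fun n t => H t * (a n (Y t))%:E).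
  rewrite (_ : integral _ _ (fun t => limn _) = \int[P]_t (H t * g (Y t))); last first.
    apply: eq_integral => t _; apply/cvg_lim => //.
    by apply: cvgeZl => //; exact: ag.
  apply.
  - move=> n; apply: emeasurable_funM => //; apply/measurable_EFinP.
    exact: measurableT_comp.
  - by move=> n t _; rewrite mule_ge0// lee_fin.
  - by move=> t _ n m nm; rewrite lee_wpmul2l//; exact: ande.
have h2 : \int[P]_t (H t * (a n (Y t))%:E) @[n --> \oo] -->
    c * \int[mu]_u g u.
  under eq_fun do rewrite law_nnsfun.
  apply: cvgeZl => //.
  have := @cvg_monotone_convergence _ _ _ mu setT measurableT
      (fun n t => (a n t)%:E).
  rewrite (_ : integral _ _ (fun t => limn _) = \int[mu]_t (g t)); last first.
    by apply: eq_integral => t _; apply/cvg_lim => //; exact: ag.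
  apply.
  - by move=> n; apply/measurable_EFinP.
  - by move=> n t _; rewrite lee_fin.
  - by move=> t _ n m nm; exact: ande.
exact: (cvg_unique _ h1 h2).
Qed.

End weighted_law.

Section affine.
Context {R : realType}.
Local Notation lambda := (@lebesgue_measure R).

(** Rescaled, the left-hand side is a measure in [B] that agrees with Lebesgue
    measure on half-open intervals. *)
Lemma lebesgue_measure_affine (a b : R) (B : set R) : 0 < a -> measurable B ->
  lambda ((fun x => a * x + b) @^-1` B) = (a^-1%:E * lambda B)%E.
Proof.
move=> a0 mB.
pose Y : measurableTypeR R -> measurableTypeR R := fun x => a * x + b.
have mY : measurable_fun setT Y.
  by apply: measurable_funD => //; apply: measurable_funM.
have a00 : 0 <= a by exact: ltW.
have := @lebesgue_measure_unique R (mscale (NngNum a00) (pushforward lambda Y)).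
move=> /(_ mY _ B mB) -> /=; last first.
  move=> _ [[c d] _ <-].
  rewrite /mscale/= /pushforward (_ : _ @^-1` _ = `](c - b) / a, (d - b) / a]%classic).
    rewrite !lebesgue_measure_itv/= !lte_fin.
    rewrite ltr_pM2r ?invr_gt0// ltrD2r; case: ifPn => // _.
      rewrite -!EFinD -EFinM; congr EFin; field; exact: lt0r_neq0.
    by rewrite mule0.
  apply/seteqP; split => x /=; rewrite !in_itv/= ltr_pdivrMr// ler_pdivlMr//;
   by rewrite /Y ltrBlDr lerBrDr mulrC.
rewrite /mscale/= muleA -EFinM mulVf ?lt0r_neq0//.
by rewrite mul1e.
Qed.

Lemma ge0_integral_affine (a b : R) (g : R -> \bar R) : 0 < a ->
  measurable_fun setT g -> (forall u, (0 <= g u)%E) ->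
  (\int[lambda]_x g (a * x + b)%R = a^-1%:E * \int[lambda]_x g x)%E.
Proof.
move=> a0 mg g0.
rewrite -(@ge0_integral_weighted_law _ _ _ _ _ lambda lambda
  (fun x => a * x + b)%R (cst 1%E))//.
- by apply: eq_integral => x _; rewrite mul1e.
- by apply: measurable_funD => //; apply: measurable_funM.
- move=> B mB; rewrite -(lebesgue_measure_affine b)// integral_cst/= ?mul1e//.
  rewrite -[X in measurable X]setTI.
  by apply: measurable_funD => //; apply: measurable_funM.
Qed.

End affine.

Section gaussian.
Context {R : realType}.
Local Notation lambda := (@lebesgue_measure R).

Lemma integral_normal_prob (m s : R) (g : R -> \bar R) :
  measurable_fun setT g -> (forall u, (0 <= g u)%E) ->
  (\int[normal_prob m s]_x g x = \int[lambda]_x ((normal_pdf m s x)%:E * g x))%E.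
Proof.
move=> mg g0.
rewrite (@ge0_integral_weighted_law _ _ _ _ _ lambda (normal_prob m s)
  id (fun x => (normal_pdf m s x)%:E) 1%E)//.
- by rewrite mul1e.
- by apply/measurable_EFinP; exact: measurable_normal_pdf.
- by move=> t; rewrite lee_fin normal_pdf_ge0.
- by move=> B mB; rewrite mul1e.
Qed.

Lemma normal_peakE (s : R) : 0 < s -> normal_peak s = s^-1 * normal_peak 1.
Proof.
move=> s0; rewrite /normal_peak expr1n mul1r -mulrnAr sqrtrM ?sqr_ge0//.
by rewrite sqrtr_sqr gtr0_norm// invfM.
Qed.

Lemma normal_pdf_posE (m s x : R) : 0 < s ->
  normal_pdf m s x = s^-1 * normal_peak 1 * expR (- (x - m) ^+ 2 / (s ^+ 2 *+ 2)).
Proof.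
by move=> s0; rewrite normal_pdfE ?lt0r_neq0// normal_peakE.
Qed.

(** The exponents of [normal_pdf_convolution]: the square in [x] is completed,
    which leaves a function of [y] alone. *)
Lemma complete_square (f s x y : R) : 0 < f -> 0 < s ->
  let v := f ^+ 2 + s ^+ 2 in
  - x ^+ 2 / (1 *+ 2) + - (y - f * x) ^+ 2 / (s ^+ 2 *+ 2) =
  - y ^+ 2 / (v *+ 2) + - (x - f * y / v) ^+ 2 / (s ^+ 2 / v *+ 2).
Proof.
move=> f0 s0 /=.
have v0 : f ^+ 2 + s ^+ 2 != 0 by rewrite lt0r_neq0// addr_gt0 ?exprn_gt0.
have s0' : s != 0 by rewrite lt0r_neq0.
rewrite -(mulr_natr (s ^+ 2)) -(mulr_natr (f ^+ 2 + _)) -(mulr_natr (s ^+ 2 / _)).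
by field; rewrite v0 s0'.
Qed.

(** The joint density of [X] and [f X + Z] is the density of the sum times the
    conditional density of [X] given the sum; both are Gaussian, so the second
    factor integrates to one whatever [y] is. *)
Lemma normal_pdf_convolution (f s x y : R) : 0 < f -> 0 < s ->
  let v := f ^+ 2 + s ^+ 2 in
  normal_pdf 0 1 x * normal_pdf 0 s (y - f * x) =
  normal_pdf 0 (Num.sqrt v) y *
  normal_pdf (f * y / v) (s / Num.sqrt v) x.
Proof.
move=> f0 s0 v.
have v0 : 0 < v by rewrite addr_gt0// exprn_gt0.
have sv0 : 0 < Num.sqrt v by rewrite sqrtr_gt0.
have sv2 : Num.sqrt v ^+ 2 = v by rewrite sqr_sqrtr// ltW.
rewrite !normal_pdf_posE// ?divr_gt0//.
rewrite mulrACA -expRD [RHS]mulrACA -expRD.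
congr (_ * expR _).
  rewrite mulrACA [RHS]mulrACA; congr (_ * _).
  rewrite invf_div mulrA; field; rewrite ?lt0r_neq0//.
rewrite expr_div_n sv2 !subr0 expr1n.
exact: complete_square.
Qed.

(** For [s = 0] the noise is a point mass and only a rescaling is left; for
    [s > 0] the order of integration is exchanged and the conditional density
    of [normal_pdf_convolution] is integrated out. *)
Lemma gaussian_sum_law (f s : R) (D : set R) : 0 < f -> 0 <= s ->
  measurable D ->
  (\int[normal_prob 0 1]_x
     gaussian_law 0 s ((fun t => f * x + t)%R @^-1` D))%E =
  normal_prob 0 (Num.sqrt (f ^+ 2 + s ^+ 2)) D.
Proof.
move=> f0 s0 mD.
have mI : measurable_fun setT (fun y : R => (\1_D y)%:E : \bar R).
  by apply/measurable_EFinP.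
have mpdf m u : measurable_fun setT (fun y : R => (normal_pdf m u y)%:E).
  by apply/measurable_EFinP; exact: measurable_normal_pdf.
have RHSE u : normal_prob 0 u D =
    (\int[lambda]_y ((normal_pdf 0 u y)%:E * (\1_D y)%:E))%E.
  rewrite -integral_normal_prob//.
  by rewrite integral_indic// setIT.
move: s0; rewrite le_eqVlt => /predU1P[<-|s0].
  rewrite expr0n/= addr0 sqrtr_sqr gtr0_norm// RHSE.
  rewrite /gaussian_law eqxx.
  transitivity (\int[normal_prob (0:R) 1]_x (\1_D (f * x)%R)%:E)%E.
    apply: eq_integral => x _; rewrite diracE !indicE.
    by rewrite (_ : (_ \in _) = (f * x \in D))//; apply/idP/idP; rewrite !inE/= addr0.
  have mf : measurable_fun setT (fun x : R => (f * x)%R).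
    exact: measurable_funM.
  rewrite integral_normal_prob//; last first.
    by apply/measurable_EFinP; apply: measurableT_comp.
  pose G (y : R) := ((normal_pdf 0 1 (f^-1 * y))%:E * (\1_D y)%:E)%E.
  have mG : measurable_fun setT G.
    apply: emeasurable_funM => //; apply/measurable_EFinP.
    by apply: measurableT_comp; [exact: measurable_normal_pdf|exact: measurable_funM].
  have G0 y : (0 <= G y)%E by rewrite mule_ge0// lee_fin ?normal_pdf_ge0.
  transitivity (\int[lambda]_x G (f * x + 0)%R)%E.
    by apply: eq_integral => x _; rewrite /G addr0 mulKf// lt0r_neq0.
  rewrite ge0_integral_affine// -ge0_integralZl//; last first.
    by rewrite lee_fin invr_ge0 ltW.
  apply: eq_integral => y _; rewrite /G muleA; congr (_ * _)%E; rewrite -EFinM; congr EFin.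
  rewrite !normal_pdf_posE// invr1 mul1r -mulrA; congr (_ * (_ * expR _)).
  rewrite -(mulr_natr (1 ^+ 2)) -(mulr_natr (f ^+ 2)).
  by field; exact: lt0r_neq0.
rewrite RHSE /gaussian_law gt_eqF//.
pose F (z : R * R) : \bar R :=
  ((normal_pdf 0 1 z.1)%:E * ((normal_pdf 0 s (z.2 - f * z.1))%:E
   * (\1_D z.2)%:E))%E.
have mF : measurable_fun setT F.
  apply: emeasurable_funM.
    apply/measurable_EFinP; apply: measurableT_comp => //.
    exact: measurable_normal_pdf.
  apply: emeasurable_funM; last first.
    by apply/measurable_EFinP; apply: measurableT_comp.
  apply/measurable_EFinP; apply: measurableT_comp => //.
    exact: measurable_normal_pdf.
  by apply: measurable_funB => //; apply: measurable_funM.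
have F0 z : (0 <= F z)%E by rewrite !mule_ge0// lee_fin ?normal_pdf_ge0.
have inner x : normal_prob 0 s ((fun t => f * x + t) @^-1` D) =
    (\int[lambda]_y ((normal_pdf 0 s (y - f * x))%:E * (\1_D y)%:E))%E.
  have mt : measurable_fun setT (fun t : R => f * x + t) by exact: measurable_funD.
  rewrite -[LHS]/(normal_prob 0 s _).
  have -> : normal_prob 0 s ((fun t => f * x + t) @^-1` D) =
      (\int[normal_prob 0 s]_t (\1_D (f * x + t)%R)%:E)%E.
    rewrite -[X in normal_prob _ _ X]setIT -integral_indic//.
    by rewrite -[X in measurable X]setTI; exact: mt.
  rewrite integral_normal_prob//; last first.
    by apply/measurable_EFinP; apply: measurableT_comp.
  pose G (y : R) := ((normal_pdf 0 s (y - f * x))%:E * (\1_D y)%:E)%E.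
  have mG : measurable_fun setT G.
    apply: emeasurable_funM => //; apply/measurable_EFinP.
    by apply: measurableT_comp; [exact: measurable_normal_pdf|exact: measurable_funB].
  have G0 y : (0 <= G y)%E by rewrite mule_ge0// lee_fin ?normal_pdf_ge0.
  transitivity (\int[lambda]_t G (1 * t + f * x)%R)%E.
    by apply: eq_integral => t _; rewrite /G mul1r addrK addrC.
  by rewrite ge0_integral_affine// invr1 mul1e.
under eq_integral do rewrite inner.
have mF1 x : measurable_fun setT (fun y : R =>
    ((normal_pdf 0 s (y - f * x))%:E * (\1_D y)%:E)%E).
  apply: emeasurable_funM => //; apply/measurable_EFinP.
  by apply: measurableT_comp; [exact: measurable_normal_pdf|exact: measurable_funB].
have F10 x y : (0 <= (normal_pdf 0 s (y - f * x))%:E * (\1_D y)%:E)%E.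
  by rewrite mule_ge0// lee_fin ?normal_pdf_ge0.
have mF2 : measurable_fun setT (fun z : R * R =>
    ((normal_pdf 0 s (z.2 - f * z.1))%:E * (\1_D z.2)%:E)%E).
  apply: emeasurable_funM; last first.
    by apply/measurable_EFinP; apply: measurableT_comp.
  apply/measurable_EFinP; apply: measurableT_comp => //.
    exact: measurable_normal_pdf.
  by apply: measurable_funB => //; apply: measurable_funM.
rewrite integral_normal_prob//; first last.
- by move=> x; apply: integral_ge0 => y _.
- exact: (@measurable_fun_fubini_tonelli_F _ _ _ _ _ lambda _ mF2).
transitivity (\int[lambda]_x \int[lambda]_y F (x, y))%E.
  apply: eq_integral => x _; rewrite -ge0_integralZl//.
    exact: mF1.
  by rewrite lee_fin normal_pdf_ge0.
apply: (etrans (@fubini_tonelli _ _ _ _ R lambda lambda F mF F0)).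
apply: eq_integral => y _.
set v := f ^+ 2 + s ^+ 2.
have v0 : 0 < v by rewrite addr_gt0// exprn_gt0.
transitivity (\int[lambda]_x (((normal_pdf 0 (Num.sqrt v) y)%:E * (\1_D y)%:E) *
    (normal_pdf (f * y / v) (s / Num.sqrt v) x)%:E))%E.
  apply: eq_integral => x _; rewrite /F/= muleA -EFinM.
  by rewrite normal_pdf_convolution// EFinM muleAC.
rewrite ge0_integralZl//.
- by rewrite integral_normal_pdf mule1.
- exact: mpdf.
- by move=> x _; rewrite lee_fin normal_pdf_ge0.
- by rewrite mule_ge0// lee_fin normal_pdf_ge0.
Qed.

End gaussian.

Section gaussian_moments.
Context {R : realType}.
Local Notation lambda := (@lebesgue_measure R).

(** The bound [ln (1 - z) >= - z - z^2].  For positive [z] the tangent-line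
    bound of the exponential is too weak and is applied at half the argument,
    then squared. *)
Lemma expR_1B_ge1 (z : R) : `|z| <= 1 / 4 -> 1 <= (1 - z) * expR (z + z ^+ 2).
Proof.
rewrite ler_norml => /andP[z1 z2].
have [z0|z0] := lerP z 0.
  have : 1 + (z + z ^+ 2) <= expR (z + z ^+ 2) by exact: expR_ge1Dx.
  move=> /(ler_wpM2l (_ : 0 <= 1 - z)) -/(_ ltac:(lra)); apply: le_trans.
  nra.
have -> : expR (z + z ^+ 2) = expR ((z + z ^+ 2) / 2) ^+ 2.
  by rewrite -expRM_natl; congr expR; field.
have h : 1 + (z + z ^+ 2) / 2 <= expR ((z + z ^+ 2) / 2) by exact: expR_ge1Dx.
have h2 : (1 + (z + z ^+ 2) / 2) ^+ 2 <= expR ((z + z ^+ 2) / 2) ^+ 2.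
  by rewrite lerXn2r// nnegrE ?expR_ge0//; nra.
move: h2 => /(ler_wpM2l (_ : 0 <= 1 - z)) -/(_ ltac:(lra)); apply: le_trans.
have -> : (1 - z) * (1 + (z + z ^+ 2) / 2) ^+ 2 =
   1 + z ^+ 2 * (1 - 3 * z - z ^+ 2 - z ^+ 3) / 4 by field.
rewrite lerDl divr_ge0// mulr_ge0 ?sqr_ge0//.
have : z ^+ 2 <= 1 / 16 by nra.
have : z ^+ 3 <= 1 / 16 by rewrite exprS; nra.
lra.
Qed.

(** The weight turns the density of variance [v] into that of variance
    [v / (1 - 2 l v)], up to a constant factor. *)
Lemma integral_normal_expR_sqr (v l : R) : 0 < v -> 0 < 1 - 2 * l * v ->
  (\int[normal_prob 0 (Num.sqrt v)]_y (expR (l * y ^+ 2))%:E =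
   ((Num.sqrt (1 - 2 * l * v))^-1)%:E)%E.
Proof.
move=> v0 lv; set q := 1 - 2 * l * v.
have sv0 : 0 < Num.sqrt v by rewrite sqrtr_gt0.
have sq0 : 0 < Num.sqrt q by rewrite sqrtr_gt0.
have me : measurable_fun setT (fun y : R => expR (l * y ^+ 2)).
  by apply: measurableT_comp => //; apply: measurable_funM.
rewrite integral_normal_prob//; last exact/measurable_EFinP.
transitivity (\int[lambda]_x (((Num.sqrt q)^-1)%:E *
    (normal_pdf 0 (Num.sqrt v / Num.sqrt q) x)%:E))%E.
  apply: eq_integral => y _; rewrite -!EFinM; congr EFin.
  rewrite !normal_pdf_posE ?divr_gt0//.
  rewrite -[LHS]mulrA -expRD invf_div !mulrA.
  congr (_ * _ * expR _).
    by rewrite mulVf ?mul1r// lt0r_neq0.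
  rewrite expr_div_n !sqr_sqrtr ?(ltW lv)// ?ltW// -(mulr_natr v) -(mulr_natr (v / q)) /q.
  by field; rewrite -?/q ?lt0r_neq0.
rewrite ge0_integralZl//.
- by rewrite integral_normal_pdf mule1.
- by apply/measurable_EFinP; exact: measurable_normal_pdf.
- by move=> x _; rewrite lee_fin normal_pdf_ge0.
Qed.

(** Centred squares of Gaussian variables are sub-exponential: for small [l]
    their exponential moments are of Gaussian type, with variance proxy of
    order [v^2]. *)
Lemma integral_normal_expR_centered (v l : R) : 0 < v -> `|l| * v <= 1 / 8 ->
  (\int[normal_prob 0 (Num.sqrt v)]_y (expR (l * (y ^+ 2 - v)))%:E <=
   (expR (2 * (l * v) ^+ 2))%:E)%E.
Proof.
move=> v0 lv; have lv' : `|2 * l * v| <= 1 / 4.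
  by rewrite !normrM (gtr0_norm v0) ger0_norm// -mulrA; lra.
have lv2 : 0 < 1 - 2 * l * v by move: lv'; rewrite ler_norml => /andP[]; lra.
rewrite [leLHS](_ : _ = \int[normal_prob 0 (Num.sqrt v)]_y
    ((expR (- l * v))%:E * (expR (l * y ^+ 2))%:E))%E; last first.
  by under eq_integral do rewrite mulrBr addrC expRD EFinM -mulNr.
have me : measurable_fun setT (fun y : R => expR (l * y ^+ 2)).
  by apply: measurableT_comp => //; apply: measurable_funM.
rewrite ge0_integralZl ?lee_fin ?expR_ge0//; last exact/measurable_EFinP.
rewrite integral_normal_expR_sqr// -EFinM lee_fin.
have q0 : 0 < Num.sqrt (1 - 2 * l * v) by rewrite sqrtr_gt0.
rewrite ler_pdivrMr// -(@ler_pXn2r _ 2)// ?nnegrE ?mulr_ge0 ?expR_ge0 ?(ltW q0)//.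
rewrite exprMn sqr_sqrtr ?(ltW lv2)// -!expRM_natl.
have := expR_1B_ge1 lv'.
rewrite -(ler_pM2l (expR_gt0 (2 * (- l * v)))) mulr1 => /le_trans; apply.
rewrite mulrCA -expRD mulrC; apply: ler_wpM2r; first exact: ltW.
by rewrite ler_expR le_eqVlt; apply/orP; left; apply/eqP; ring.
Qed.

Definition likelihood_ratio (v0 v1 y : R) : R :=
  normal_pdf 0 (Num.sqrt v1) y / normal_pdf 0 (Num.sqrt v0) y.

Lemma likelihood_ratio_ge0 v0 v1 y : 0 <= likelihood_ratio v0 v1 y.
Proof. by rewrite divr_ge0 ?normal_pdf_ge0. Qed.

Lemma measurable_likelihood_ratio v0 v1 : 0 < v0 ->
  measurable_fun setT (likelihood_ratio v0 v1).
Proof.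
move=> v00; apply: measurable_funM; first exact: measurable_normal_pdf.
apply: continuous_measurable_fun => x.
apply: cvgV; last by apply: continuous_normal_pdf; rewrite lt0r_neq0// sqrtr_gt0.
by rewrite normal_pdf_posE ?sqrtr_gt0// lt0r_neq0// mulr_gt0 ?expR_gt0// mulr_gt0 ?normal_peak_gt0 ?invr_gt0 ?sqrtr_gt0.
Qed.

Lemma normal_pdf_gt0 (s y : R) : 0 < s -> 0 < normal_pdf 0 s y.
Proof.
move=> s0.
by rewrite normal_pdf_posE// mulr_gt0 ?expR_gt0// mulr_gt0 ?normal_peak_gt0 ?invr_gt0.
Qed.

Lemma integral_likelihood_ratio (v0 v1 : R) (B : set R) : 0 < v0 ->
  measurable B ->
  (\int[normal_prob 0 (Num.sqrt v0)]_y
     ((likelihood_ratio v0 v1 y)%:E * (\1_B y)%:E) =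
   normal_prob 0 (Num.sqrt v1) B)%E.
Proof.
move=> v00 mB.
have mlr : measurable_fun setT (fun y => (likelihood_ratio v0 v1 y)%:E).
  by apply/measurable_EFinP; exact: measurable_likelihood_ratio.
have m1 : measurable_fun setT (fun y : R => (\1_B y)%:E : \bar R).
  by apply/measurable_EFinP.
rewrite integral_normal_prob//; first last.
- by move=> y; rewrite mule_ge0// lee_fin// likelihood_ratio_ge0.
- exact: emeasurable_funM.
transitivity (\int[normal_prob 0 (Num.sqrt v1)]_y (\1_B y)%:E)%E; last first.
  by rewrite integral_indic// setIT.
rewrite integral_normal_prob//.
apply: eq_integral => y _; rewrite muleA; congr (_ * _)%E; rewrite -EFinM mulrCA divff ?mulr1//.
by rewrite lt0r_neq0// normal_pdf_gt0// sqrtr_gt0.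
Qed.

(** The cost of telling two centred Gaussian laws apart is quadratic in the
    relative change [u] of the variance.  When the variance is
    [f^2 + sigma^2], a change of [f] of a given size has [u] of order
    [1 / max 1 (sigma^2)]: this is where the factor [sigma^4] of the rate comes
    from. *)
Lemma integral_likelihood_ratio_sqr (v0 u : R) : 0 < v0 -> 0 <= u <= 1 / 2 ->
  (\int[normal_prob 0 (Num.sqrt v0)]_y
     ((likelihood_ratio v0 (v0 * (1 + u)) y ^+ 2)%:E) <= (expR (u ^+ 2))%:E)%E.
Proof.
move=> v00 /andP[u0 u1]; set v1 := v0 * (1 + u).
have v10 : 0 < v1 by rewrite mulr_gt0//; lra.
have sv0 : 0 < Num.sqrt v0 by rewrite sqrtr_gt0.
have sv1 : 0 < Num.sqrt v1 by rewrite sqrtr_gt0.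
pose l := u / v1.
rewrite [leLHS](_ : _ = \int[normal_prob 0 (Num.sqrt v0)]_y
    ((1 + u)^-1%:E * (expR (l * y ^+ 2))%:E))%E; last first.
  apply: eq_integral => y _; rewrite -EFinM; congr EFin.
  rewrite /likelihood_ratio !normal_pdf_posE//.
  rewrite !subr0 !sqr_sqrtr ?(ltW v00) ?(ltW v10)//.
  set E0 := expR _; set E1 := expR _.
  have p0 : normal_peak (1 : R) != 0 by rewrite lt0r_neq0// normal_peak_gt0.
  have -> : (Num.sqrt v1)^-1 * normal_peak 1 * E0 /
      ((Num.sqrt v0)^-1 * normal_peak 1 * E1) =
      Num.sqrt v0 / Num.sqrt v1 * (E0 / E1).
    by field; rewrite p0 !lt0r_neq0// expR_gt0.
  rewrite exprMn expr_div_n !sqr_sqrtr ?(ltW v00) ?(ltW v10)//.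
  congr (_ * _); first by rewrite /v1; field; rewrite !lt0r_neq0//; lra.
  rewrite /E0 /E1 -expRN -expRD -expRM_natl; congr expR.
  rewrite -(mulr_natr v0) -(mulr_natr v1) /l /v1.
  by field; rewrite !lt0r_neq0//; lra.
have l8 : 0 < 1 - 2 * l * v0.
  rewrite /l /v1 (_ : 1 - _ = (1 - u) / (1 + u)); last by field; rewrite !lt0r_neq0//; lra.
  by rewrite divr_gt0//; lra.
have me : measurable_fun setT (fun y : R => expR (l * y ^+ 2)).
  by apply: measurableT_comp => //; apply: measurable_funM.
rewrite ge0_integralZl//; first last.
- by rewrite lee_fin invr_ge0; lra.
- exact/measurable_EFinP.
rewrite integral_normal_expR_sqr// -EFinM lee_fin.
rewrite -invfM invf_ple ?posrE ?expR_gt0 ?mulr_gt0 ?sqrtr_gt0//; last by lra.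
rewrite -expRN -(@ler_pXn2r _ 2)// ?nnegrE ?mulr_ge0 ?expR_ge0 ?sqrtr_ge0//; last by lra.
rewrite exprMn sqr_sqrtr ?(ltW l8)// -expRM_natl.
have -> : (1 + u) ^+ 2 * (1 - 2 * l * v0) = 1 - u ^+ 2.
  by rewrite /l /v1; field; rewrite !lt0r_neq0//; lra.
have uu : `|u ^+ 2| <= 1 / 4 by rewrite ger0_norm ?sqr_ge0//; nra.
have := expR_1B_ge1 uu.
rewrite -(ler_pM2l (expR_gt0 (2 * (- u ^+ 2)))) mulr1 => /le_trans; apply.
have u4 : u ^+ 2 <= 1 / 4 by move: uu; rewrite ger0_norm ?sqr_ge0.
have u2 := sqr_ge0 u.
rewrite mulrCA -expRD -[leRHS]mulr1 ler_wpM2l ?subr_ge0//; first by lra.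
rewrite -[leRHS]expR0 ler_expR.
by move: (u ^+ 2) u2 u4 => w w0 w4; nra.
Qed.

End gaussian_moments.

(** * Joint law of independent Gaussian sums *)

(** The law of a random variable and [normal_prob] live on measurable spaces
    that are presented differently, so that the two measures are compared
    through the identity map. *)
Lemma integral_normal_law (R : realType) (M : {measure set R -> \bar R}) (m s : R)
    (g : R -> \bar R) :
  (forall A, measurable A -> M A = normal_prob m s A) ->
  measurable_fun setT g -> (forall x, 0 <= g x)%E ->
  (\int[M]_x g x = \int[normal_prob m s]_x g x)%E.
Proof.
move=> law mg g0.
rewrite -[RHS]mul1e -(@ge0_integral_weighted_law _ _ _ _ _ M (normal_prob m s)
  id (cst 1%E))//.
- by apply: eq_integral => x _; rewrite mul1e.
- by move=> B mB; rewrite integral_cst//= mul1e law// mul1e.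
Qed.

Section independent_sums.
Local Open Scope ereal_scope.
Context d (T : measurableType d) (R : realType) (P : probability T R).
Context (n : nat) (X Z : 'I_n -> {RV P >-> R}) (c : 'I_n -> R) (s : R).
Hypothesis c0 : forall i, (0 < c i)%R.
Hypothesis s0 : (0 <= s)%R.
Hypothesis lawX : forall i, has_law (X i) (gaussian_law 0 1).
Hypothesis lawZ : forall i, has_law (Z i) (gaussian_law 0 s).
Hypothesis indep : forall A B : 'I_n -> set R,
  (forall i, measurable (A i)) -> (forall i, measurable (B i)) ->
  P (\bigcap_i (X i @^-1` A i `&` Z i @^-1` B i)) =
  \prod_i (P (X i @^-1` A i) * P (Z i @^-1` B i)).

Let Y (i : 'I_n) (t : T) : R := (c i * X i t + Z i t)%R.
Let nu (i : 'I_n) := normal_prob 0 (Num.sqrt (c i ^+ 2 + s ^+ 2)).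

Let mY i : measurable_fun setT (Y i).
Proof. by apply: measurable_funD => //; apply: measurable_funM. Qed.

Let mpre (f : T -> R) (B : set R) : measurable_fun setT f -> measurable B ->
  measurable (f @^-1` B).
Proof. by move=> mf mB; rewrite -[X in measurable X]setTI; exact: mf. Qed.

(** The hybrid family in which the first [k] coordinates already carry an event
    on the combination [Y i], and the others a rectangle for the pair. *)
Let event (k : nat) (D A B : 'I_n -> set R) (i : 'I_n) : set T :=
  if (i < k)%N then Y i @^-1` D i else X i @^-1` A i `&` Z i @^-1` B i.

Let weight (k : nat) (D A B : 'I_n -> set R) (i : 'I_n) : \bar R :=
  if (i < k)%N then nu i (D i) else P (X i @^-1` A i) * P (Z i @^-1` B i).

Let measurable_event k D A B : (forall i, measurable (D i)) ->
  (forall i, measurable (A i)) -> (forall i, measurable (B i)) ->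
  forall i, measurable (event k D A B i).
Proof.
move=> mD mA mB i; rewrite /event; case: ifPn => _; first exact: mpre.
by apply: measurableI; exact: mpre.
Qed.

Let pair_law (k : 'I_n) (D : set R) : measurable D ->
  (distribution P (X k) \x distribution P (Z k))
    [set z | D (c k * z.1 + z.2)%R] = nu k D.
Proof.
move=> mD; rewrite /nu -(gaussian_sum_law (c0 k) s0 mD).
rewrite /product_measure1.
have mm : measurable_fun setT (fun z : R * R => c k * z.1 + z.2)%R.
  by apply: measurable_funD => //; apply: measurable_funM.
have mC : measurable [set z : R * R | D (c k * z.1 + z.2)%R].
  by rewrite -[X in measurable X]setTI; exact: mm.
rewrite (@integral_normal_law _ _ 0 1).
- apply: eq_integral => x _ /=.
  rewrite -(lawZ k); last first.
    rewrite -[X in measurable X]setTI.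
    have mt : measurable_fun setT (fun t : R => c k * x + t)%R.
      exact: measurable_funD.
    exact: mt.
  congr (distribution P (Z k) _); apply/seteqP; split => y /=.
    by rewrite /xsection/= inE.
  by rewrite /xsection/= inE.
- by move=> A mA; have := lawX k mA; rewrite /gaussian_law oner_eq0.
- exact: measurable_fun_xsection.
- by move=> x.
Qed.

(** With the other coordinates frozen, the probability is a finite measure in
    the event carried by the [k]-th pair; it is known on rectangles, hence on
    every planar set, in particular on the preimage of an event under the
    linear combination. *)
Let replace_step (k : 'I_n) (D A B : 'I_n -> set R) :
  (forall i, measurable (D i)) ->
  (forall i, measurable (A i)) -> (forall i, measurable (B i)) ->
  (forall A B, (forall i, measurable (A i)) -> (forall i, measurable (B i)) ->
    P (\bigcap_i event k D A B i) = \prod_i weight k D A B i) ->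
  P (\bigcap_i event k.+1 D A B i) = \prod_i weight k.+1 D A B i.
Proof.
move=> mD mA mB IH.
pose F := \bigcap_(i in [set i | i != k]) event k D A B i.
have mF : measurable F.
  by apply: measurable_bigcap_ord; exact: measurable_event.
pose W : \bar R := \prod_(i | i != k) weight k D A B i.
have Wfin : W \is a fin_num.
  apply: prode_fin_num => i _; rewrite /weight; case: ifPn => _.
    rewrite /nu fin_num_measure//; exact: mD.
  by rewrite fin_numM// fin_num_measure//; exact: mpre.
have W0 : 0 <= W.
  by apply: prode_ge0 => i _; rewrite /weight; case: ifPn => // _; rewrite mule_ge0.
have w0 : (0 <= fine W)%R by exact: fine_ge0.
pose XZ t := (X k t, Z k t).
have mXZ : measurable_fun setT XZ by exact: measurable_fun_pair.
have key C : measurable C -> P (F `&` XZ @^-1` C) =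
    W * (distribution P (X k) \x distribution P (Z k)) C.
  move=> mC.
  pose M1 := pushforward (mrestr P mF) XZ.
  pose M2 := mscale (NngNum w0) (distribution P (X k) \x distribution P (Z k)).
  pose G := [set A' `*` B' | A' in @measurable _ R & B' in @measurable _ R].
  have M12 : forall A, measurable A -> M1 A = M2 A.
    apply: (measure_unique G (fun=> setT)).
    - by rewrite measurable_prod_measurableType.
    - move=> _ _ [A1 mA1 [B1 mB1 <-]] [A2 mA2 [B2 mB2 <-]].
      rewrite -setXI; exists (A1 `&` A2); first exact: measurableI.
      by exists (B1 `&` B2) => //; exact: measurableI.
    - by move=> _; exists setT => //; exists setT => //; rewrite setXTT.
    - by rewrite bigcup_const.
    - move=> _ [A1 mA1 [B1 mB1 <-]].
      rewrite /M1 /M2 /pushforward /mrestr.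
      rewrite -[RHS]/((fine W)%:E * (distribution P (X k) \x distribution P (Z k))
        (A1 `*` B1)) product_measure1E// fineK//.
      pose A' i := if i == k then A1 else A i.
      pose B' i := if i == k then B1 else B i.
      have mA' i : measurable (A' i) by rewrite /A'; case: ifP.
      have mB' i : measurable (B' i) by rewrite /B'; case: ifP.
      have := IH A' B' mA' mB'; rewrite (bigcap_ordD1 k) (bigD1 k)//=.
      rewrite (_ : \bigcap_(i in _) _ = F); last first.
        apply: eq_bigcapr => i /= ik.
        by rewrite /event /A' /B' (negbTE ik).
      rewrite (eq_bigr (weight k D A B)); last first.
        by move=> i ik; rewrite /weight /A' /B' (negbTE ik).
      rewrite -/W {1}/event {1}/weight ltnn /A' /B' !eqxx => H.
      by rewrite muleC -H setIC.
    - move=> _; rewrite -[ltLHS]/(P (XZ @^-1` setT `&` F)) preimage_setT setTI.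
      by apply: le_lt_trans (ltry 1); apply: probability_le1.
  have := M12 _ mC.
  rewrite -[X in X = _]/(P (XZ @^-1` C `&` F)) -[X in _ = X]/((fine W)%:E * _).
  by rewrite fineK// setIC.
rewrite (bigcap_ordD1 k) (bigD1 k)//=.
have ikE (i : 'I_n) : i != k -> (i < k.+1)%N = (i < k)%N.
  by move=> ik; rewrite ltnS leq_eqVlt val_eqE (negbTE ik).
rewrite (_ : \bigcap_(i in _) _ = F); last first.
  by apply: eq_bigcapr => i /= ik; rewrite /event ikE.
rewrite (eq_bigr (weight k D A B)); last first.
  by move=> i ik; rewrite /weight ikE.
rewrite -/W {1}/event {1}/weight ltnSn -pair_law// muleC -key//.
rewrite -[X in measurable X]setTI.
have mm : measurable_fun setT (fun z : R * R => c k * z.1 + z.2)%R.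
  by apply: measurable_funD => //; apply: measurable_funM.
exact: mm.
Qed.

(** Independence passes from the pairs to their linear combinations, one pair
    at a time. *)
Lemma independent_sums_law (D : 'I_n -> set R) : (forall i, measurable (D i)) ->
  P (\bigcap_i (fun t => c i * X i t + Z i t)%R @^-1` D i) =
  \prod_i normal_prob 0 (Num.sqrt (c i ^+ 2 + s ^+ 2)) (D i).
Proof.
move=> mD.
have H k : (k <= n)%N -> forall A B, (forall i, measurable (A i)) ->
    (forall i, measurable (B i)) ->
    P (\bigcap_i event k D A B i) = \prod_i weight k D A B i.
  elim: k => [|k IH] kn A B mA mB.
    rewrite (_ : \bigcap_i _ = \bigcap_i (X i @^-1` A i `&` Z i @^-1` B i)) ?indep//.
  by apply: (@replace_step (Ordinal kn)) => //=; apply: IH; exact: ltnW.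
have := H n (leqnn n) D D mD mD.
rewrite (_ : \bigcap_i _ = \bigcap_i (Y i @^-1` D i)); last first.
  by apply: eq_bigcapr => i _; rewrite /event ltn_ord.
by move=> ->; apply: eq_bigr => i _; rewrite /weight ltn_ord.
Qed.

End independent_sums.

(** * Expectations of products and change of measure *)

Section product_expectation.
Local Open Scope ereal_scope.
Context d (T : measurableType d) (R : realType) (P : {measure set T -> \bar R}).
Context (n : nat) (Y : 'I_n -> T -> R) (sd : 'I_n -> R).
Hypothesis mY : forall i, measurable_fun setT (Y i).
Hypothesis lawY : forall D : 'I_n -> set R, (forall i, measurable (D i)) ->
  P (\bigcap_i Y i @^-1` D i) = \prod_i normal_prob 0 (sd i) (D i).

(** Indicators are replaced by functions one coordinate at a time; each
    replacement is an instance of [ge0_integral_weighted_law] whose weight is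
    the product over the other coordinates. *)
Lemma integral_prod_independent (g : 'I_n -> R -> R) :
  (forall i, measurable_fun setT (g i)) -> (forall i y, (0 <= g i y)%R) ->
  (forall i, \int[normal_prob 0 (sd i)]_y (g i y)%:E \is a fin_num) ->
  \int[P]_t (\prod_i g i (Y i t))%:E =
  \prod_i \int[normal_prob 0 (sd i)]_y (g i y)%:E.
Proof.
move=> mg g0 gfin.
pose F k (D : 'I_n -> set R) (i : 'I_n) (t : T) : \bar R :=
  (if (i < k)%N then g i (Y i t) else \1_(D i) (Y i t))%:E.
pose w k (D : 'I_n -> set R) (i : 'I_n) : \bar R :=
  if (i < k)%N then \int[normal_prob 0 (sd i)]_y (g i y)%:E
  else normal_prob 0 (sd i) (D i).
have F0 k D i t : 0 <= F k D i t by rewrite lee_fin; case: ifP.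
have mF k D i : measurable (D i) -> measurable_fun setT (F k D i).
  move=> mD; rewrite /F; case: (i < k)%N; apply/measurable_EFinP.
    exact: measurableT_comp.
  by apply: measurableT_comp; [exact: measurable_indic|exact: mY].
have mFs k D (Q : pred 'I_n) : (forall i, measurable (D i)) ->
    measurable_fun setT (fun t => \prod_(i | Q i) F k D i t).
  by move=> mD; apply: measurable_prode => i; exact: mF.
have ikE (i k : 'I_n) : i != k -> (i < k.+1)%N = (i < k)%N.
  by move=> ik; rewrite ltnS leq_eqVlt val_eqE (negbTE ik).
have H k : (k <= n)%N -> forall D, (forall i, measurable (D i)) ->
    \int[P]_t (\prod_i F k D i t) = \prod_i w k D i.
  elim: k => [_ D mD|k IH kn D mD].
    rewrite /w/= -lawY// -[X in P X]setIT -integral_indic//; last first.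
      apply: measurable_bigcap_ord => i.
      by rewrite -[X in measurable X]setTI; exact: mY.
    apply: eq_integral => t _; rewrite /F/= prodEFin; congr EFin.
    rewrite indicE; have [tD|tD] := boolP (t \in _).
      rewrite big1// => i _; rewrite indicE mem_set//.
      by move: tD; rewrite inE => /(_ i Logic.I).
    move: tD; rewrite notin_setE => /existsNP[i] /not_implyP[_ YD].
    by rewrite (bigD1 i)//= indicE memNset// mul0r.
  pose kk := Ordinal kn.
  transitivity (\int[P]_t ((\prod_(i | i != kk) F k D i t) * (g kk (Y kk t))%:E)).
    apply: eq_integral => t _; rewrite (bigD1 kk)//= muleC {2}/F/= ltnSn.
    by congr (_ * _); apply: eq_bigr => i ik; rewrite /F (ikE i kk ik).
  rewrite (bigD1 kk)//= {1}/w ltnSn muleC (eq_bigr (w k D)); last first.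
    by move=> i ik; rewrite /w (ikE i kk ik).
  apply: (@ge0_integral_weighted_law _ _ T (measurableTypeR R) R P
    (normal_prob 0 (sd kk)) (Y kk) (fun t => \prod_(i | i != kk) F k D i t)
    _ _ _ _ _ _ _ (fun y => (g kk y)%:E)) => //.
  - exact: (mY kk).
  - exact: mFs.
  - by move=> t; apply: prode_ge0.
  - by move=> t; apply: prode_fin_num.
  - apply: prode_fin_num => i _; rewrite /w; case: ifP => // _.
    rewrite fin_num_measure//; exact: mD.
  - move=> B mB; pose D' i := if i == kk then B else D i.
    have mD' i : measurable (D' i) by rewrite /D'; case: (i == kk); [exact: mB|exact: mD].
    have wkk : w k D' kk = normal_prob 0 (sd kk) B by rewrite /w ltnn /D' eqxx.
    have Fkk t : F k D' kk t = (\1_B (Y kk t))%:E by rewrite /F ltnn /D' eqxx.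
    have := IH (ltnW kn) D' mD'; rewrite (bigD1 kk)//= wkk muleC.
    rewrite (eq_bigr (w k D)); last first.
      by move=> i ik; rewrite /w /D' (negbTE ik).
    move=> <-; rewrite [LHS]integral_mkcond; apply: eq_integral => t _.
    rewrite (bigD1 kk)//= Fkk patchE indicE.
    have -> : \prod_(i | i != kk) F k D' i t = \prod_(i | i != kk) F k D i t.
      by apply: eq_bigr => i ik; rewrite /F /D' (negbTE ik).
    case: ifPn => tB; last first.
      by rewrite memNset ?mul0e//; move: tB; rewrite notin_setE.
    by rewrite mem_set ?mul1e//; move: tB; rewrite inE.
  - by apply/measurable_EFinP; exact: (mg kk).
  - by move=> u; rewrite lee_fin; exact: g0.
have := H n (leqnn n) (fun=> setT) (fun=> measurableT).
rewrite (eq_bigr (fun i => \int[normal_prob 0 (sd i)]_y (g i y)%:E)); last first.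
  by move=> i _; rewrite /w ltn_ord.
move=> <-; apply: eq_integral => t _; rewrite -prodEFin.
by apply: eq_bigr => i _; rewrite /F ltn_ord.
Qed.

End product_expectation.

Section weighted_measure.
Local Open Scope ereal_scope.
Context d d' (T : measurableType d) (U : measurableType d') (R : realType).
Variables (P : {measure set T -> \bar R}) (Y : T -> U) (H : T -> \bar R).
Hypotheses (mY : measurable_fun setT Y) (mH : measurable_fun setT H).
Hypothesis H0 : forall t, 0 <= H t.

(** The image under [Y] of the measure of density [H].  The three facts that
    make it a measure are arguments, so that the measure structure can be
    inferred from the term. *)
Definition weighted_image of measurable_fun setT Y & measurable_fun setT H
  & (forall t, 0 <= H t) := fun B : set U => \int[P]_(t in Y @^-1` B) H t.

Let weighted_image0 : weighted_image mY mH H0 set0 = 0.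
Proof. by rewrite /weighted_image preimage_set0 integral_set0. Qed.

Let weighted_image_ge0 B : 0 <= weighted_image mY mH H0 B.
Proof. by apply: integral_ge0. Qed.

Let weighted_image_sigma_additive : semi_sigma_additive (weighted_image mY mH H0).
Proof.
move=> F mF tF mUF; rewrite /weighted_image preimage_bigcup.
rewrite ge0_integral_bigcup//.
- apply: is_cvg_ereal_nneg_natsum_cond => n _ _.
  exact: integral_ge0.
- by move=> k; rewrite -[X in measurable X]setTI; exact: mY.
- exact: measurable_funTS.
- apply/trivIsetP => i j _ _ ij; rewrite -preimage_setI.
  by move/trivIsetP : tF => ->//; rewrite preimage_set0.
Qed.

HB.instance Definition _ := isMeasure.Build _ _ _ (weighted_image mY mH H0)
  weighted_image0 weighted_image_ge0 weighted_image_sigma_additive.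

End weighted_measure.

Section tuple_law.
Local Open Scope ereal_scope.
Context (R : realType) (n : nat).

Definition box (D : 'I_n -> set R) : set (n.-tuple R) :=
  [set y | forall i, D i (tnth y i)].

Lemma measurable_tuple_box : @measurable _ (n.-tuple R) =
  <<s [set box D | D in [set D : 'I_n -> set R | forall i, measurable (D i)]] >>.
Proof.
apply/seteqP; split.
  apply: smallest_sub; first exact: smallest_sigma_algebra.
  rewrite -bigcup_seq; apply: bigcup_sub => i _ _ [A mA <-].
  apply: sub_sigma_algebra; exists (fun j => if j == i then A else setT).
    by move=> j /=; case: ifP.
  apply/seteqP; split => y /=.
    by move=> /(_ i); rewrite eqxx.
  by move=> [_ yA] j; case: eqP => // ->.
apply: smallest_sub; first exact: sigma_algebra_measurable.
move=> _ [D mD <-]; rewrite (_ : box D = \bigcap_i ((tnth (T:=R))^~ i @^-1` D i)); last first.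
  by apply/seteqP; split => y /=; [move=> yD i _; exact: yD|move=> yD i; exact: yD].
apply: measurable_bigcap_ord => i.
by rewrite -[X in measurable X]setTI; exact: measurable_tnth.
Qed.

(** Boxes are stable under intersection and generate the product
    sigma-algebra. *)
Lemma tuple_measure_unique (M1 M2 : {measure set (n.-tuple R) -> \bar R}) :
  M1 setT < +oo ->
  (forall D, (forall i, measurable (D i)) -> M1 (box D) = M2 (box D)) ->
  forall A, measurable A -> M1 A = M2 A.
Proof.
move=> M1fin M12; apply: (measure_unique _ (fun=> setT) measurable_tuple_box).
- move=> _ _ [D1 mD1 <-] [D2 mD2 <-]; exists (fun i => D1 i `&` D2 i).
    by move=> i; exact: measurableI.
  by apply/seteqP; split => y /= => [H|[H1 H2] i]; split => // i; have [] := H i.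
- by move=> _; exists (fun=> setT) => //; apply/seteqP; split.
- by rewrite bigcup_const.
- by move=> _ [D mD <-]; exact: M12.
- by [].
Qed.

End tuple_law.

Section model.
Context (R : realType) (n : nat) (s : R) (N : noise_model n s).
Hypothesis s0 : 0 <= s.
Local Notation P := (noise_prob N).

Definition obs_var (f : R -> R) (i : 'I_n) : R :=
  f (i.+1%:R / n%:R) ^+ 2 + s ^+ 2.

Lemma measurable_observation_tnth (f : R -> R) (i : 'I_n) :
  measurable_fun setT (fun w => tnth (observation (N := N) f w) i).
Proof.
under eq_fun do rewrite tnth_mktuple.
by apply: measurable_funD => //; apply: measurable_funM.
Qed.

Lemma measurable_observation (f : R -> R) :
  measurable_fun setT (observation (N := N) f).
Proof. by apply/measurable_fun_tnthP => i; exact: measurable_observation_tnth. Qed.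

Lemma noise_pairs_independent (A B : 'I_n -> set R) :
  (forall i, measurable (A i)) -> (forall i, measurable (B i)) ->
  (P (\bigcap_i (speckle_noise N i @^-1` A i `&` additive_noise N i @^-1` B i)) =
  \prod_i (P (speckle_noise N i @^-1` A i) * P (additive_noise N i @^-1` B i)))%E.
Proof.
move=> mA mB.
pose C (j : 'I_n + 'I_n) := match j with inl i => A i | inr i => B i end.
have := @noise_independent R n s N [set: 'I_n + 'I_n]%SET C.
rewrite (_ : \bigcap_(_ in _) _ =
   \bigcap_i (speckle_noise N i @^-1` A i `&` additive_noise N i @^-1` B i)); last first.
  apply/seteqP; split => t.
    move=> H i _; split; first by apply: (H (inl i)); rewrite /= inE.
    by apply: (H (inr i)); rewrite /= inE.
  by move=> H [i|i] _; have [] := H i Logic.I.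
move=> ->; last by case.
under eq_bigl do rewrite inE.
by rewrite big_sumType/= -big_split.
Qed.

Lemma observation_law (f : R -> R) (D : 'I_n -> set R) :
  (forall i : 'I_n, 0 < f (i.+1%:R / n%:R)) ->
  (forall i, measurable (D i)) ->
  (P (\bigcap_i (fun w => tnth (observation (N := N) f w) i) @^-1` D i) =
  \prod_i normal_prob 0 (Num.sqrt (obs_var f i)) (D i))%E.
Proof.
move=> f0 mD.
rewrite -(@independent_sums_law _ _ R P n (speckle_noise N) (additive_noise N)
  (fun i => f (i.+1%:R / n%:R)) s)//.
- congr (P _); apply: eq_bigcapr => i _.
  by apply/seteqP; split=> w /=; rewrite tnth_mktuple.
- exact: speckle_noise_law.
- exact: additive_noise_law.
- exact: noise_pairs_independent.
Qed.

Lemma integral_prod_observation (f : R -> R) (g : 'I_n -> R -> R) :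
  (forall i : 'I_n, 0 < f (i.+1%:R / n%:R)) ->
  (forall i, measurable_fun setT (g i)) -> (forall i y, 0 <= g i y) ->
  (forall i, (\int[normal_prob 0 (Num.sqrt (obs_var f i))]_y (g i y)%:E)%E
     \is a fin_num) ->
  (\int[P]_w (\prod_i g i (tnth (observation (N := N) f w) i))%:E =
  \prod_i \int[normal_prob 0 (Num.sqrt (obs_var f i))]_y (g i y)%:E)%E.
Proof.
move=> f0 mg g0 gfin.
apply: (@integral_prod_independent _ _ R P n
  (fun i w => tnth (observation (N := N) f w) i)) => //.
- exact: measurable_observation_tnth.
- by move=> D mD; exact: observation_law.
Qed.

(** Both sides are finite measures in [A], and on a box both factor over the
    coordinates, where the claim is the one-dimensional
    [integral_likelihood_ratio]. *)
Lemma change_of_measure (f0 f1 : R -> R) (A : set (n.-tuple R)) :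
  (forall i : 'I_n, 0 < f0 (i.+1%:R / n%:R)) ->
  (forall i : 'I_n, 0 < f1 (i.+1%:R / n%:R)) ->
  measurable A ->
  (P (observation (N := N) f1 @^-1` A) =
  \int[P]_(w in observation (N := N) f0 @^-1` A)
    (\prod_i likelihood_ratio (obs_var f0 i) (obs_var f1 i)
       (tnth (observation (N := N) f0 w) i))%:E)%E.
Proof.
move=> f00 f10 mA.
pose Y0 := observation (N := N) f0; pose Y1 := observation (N := N) f1.
pose l (i : 'I_n) := likelihood_ratio (obs_var f0 i) (obs_var f1 i).
have v0 i : 0 < obs_var f0 i by rewrite ltr_pwDl ?exprn_gt0 ?sqr_ge0.
have ml i : measurable_fun setT (l i) by exact: measurable_likelihood_ratio.
pose L w : \bar R := (\prod_i l i (tnth (Y0 w) i))%:E.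
have mL : measurable_fun setT L.
  rewrite /L; under eq_fun do rewrite -prodEFin.
  apply: measurable_prode => i; apply/measurable_EFinP.
  by apply: measurableT_comp => //; exact: measurable_observation_tnth.
have L0 w : (0 <= L w)%E by rewrite lee_fin prodr_ge0// => i _; exact: likelihood_ratio_ge0.
have mY0 := measurable_observation f0; have mY1 := measurable_observation f1.
have boxE (Y : noise_space N -> n.-tuple R) (D : 'I_n -> set R) : Y @^-1` box D = \bigcap_i (fun w => tnth (Y w) i) @^-1` D i.
  by apply/seteqP; split => w H i; [move=> _; exact: H|exact: H].
apply: (@tuple_measure_unique _ _ (pushforward P Y1) (weighted_image P mY0 mL L0) _ _ _ mA).
  by apply: le_lt_trans (ltry 1); apply: probability_le1; exact: measurableT.
move=> D mD.
rewrite -[LHS]/(P (Y1 @^-1` box D)) boxE observation_law//.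
rewrite -[RHS]/(\int[P]_(w in Y0 @^-1` box D) L w)%E [RHS]integral_mkcond.
transitivity (\int[P]_w (\prod_i (l i (tnth (Y0 w) i) * \1_(D i) (tnth (Y0 w) i)))%:E)%E; last first.
  apply: eq_integral => w _; rewrite patchE big_split/= /L.
  case: ifPn => [|] wD.
    rewrite [X in _ * X]big1 ?mulr1// => i _.
    by rewrite indicE mem_set//; move: wD; rewrite inE; exact.
  move: wD; rewrite notin_setE => /existsNP[i iD].
  by rewrite [X in _ * X](bigD1 i)//= indicE memNset// mul0r mulr0.
have intE i : (\int[normal_prob 0 (Num.sqrt (obs_var f0 i))]_y
     (l i y * \1_(D i) y)%:E = normal_prob 0 (Num.sqrt (obs_var f1 i)) (D i))%E.
  by under eq_integral do rewrite EFinM; exact: integral_likelihood_ratio.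
rewrite (@integral_prod_observation f0 (fun i y => l i y * \1_(D i) y))//.
- by apply: eq_bigr => i _; rewrite intE.
- by move=> i; apply: measurable_funM => //.
- by move=> i y; rewrite mulr_ge0 ?likelihood_ratio_ge0.
- by move=> i; rewrite intE fin_num_measure//; exact: mD.
Qed.

End model.

(** * Derivatives on the closed unit interval and Taylor expansion *)

Section derivative01.
Context {R : realType}.
Implicit Types (f g : R -> R) (x y : R).

(** Differentiability with one-sided derivatives at the endpoints.  Bounding
    increments instead of quotients avoids the exclusion of [y = x] and makes
    the condition linear in the pair of functions. *)
Definition increment01 f g := forall x, x \in `[0, 1] ->
  forall e, 0 < e -> exists2 d, 0 < d & forall y, y \in `[0, 1] ->
    `|y - x| < d -> `|f y - f x - g x * (y - x)| <= e * `|y - x|.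

Lemma has_derivative01P f g : has_derivative01 f g <-> increment01 f g.
Proof.
split=> [H x x01 e e0|H x x01].
  have /cvgrPdist_le/(_ _ e0) := H x x01.
  rewrite near_withinE /= => /nbhs_ballP[d /= d0 Hd]; exists d => // y y01 yx.
  have [->|yNx] := eqVneq y x; first by rewrite !subrr mulr0 subrr normr0 mulr0.
  have yx0 : y - x != 0 by rewrite subr_eq0.
  have := Hd y; rewrite /ball/= distrC => /(_ yx yNx y01).
  rewrite -(ler_pM2r (_ : 0 < `|y - x|)) ?normr_gt0//; apply: le_trans.
  by rewrite -normrM mulrBl divfK// distrC mulrC.
apply/cvgrPdist_le => e e0; rewrite near_withinE /=.
have [d d0 Hd] := H x x01 e e0.
apply/nbhs_ballP; exists d => //= y; rewrite /ball/= distrC => yx yNx y01.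
have yx0 : y - x != 0 by rewrite subr_eq0.
rewrite -(ler_pM2r (_ : 0 < `|y - x|)) ?normr_gt0//; apply: le_trans (Hd y y01 yx).
by rewrite -normrM mulrBl divfK// distrC mulrC.
Qed.

Lemma increment01_is_derive f g x : increment01 f g -> x \in `]0, 1[ ->
  is_derive x 1 f (g x).
Proof.
move=> H; rewrite in_itv/= => /andP[x0 x1].
have x01 : x \in `[0, 1] by rewrite in_itv/= !ltW.
have key : h^-1 *: (f (h *: 1 + x) - f x) @[h --> 0^'] --> g x.
  apply/cvgrPdist_le => e e0.
  have [d d0 Hd] := H x x01 e e0.
  pose r := Num.min d (Num.min x (1 - x)).
  have r0 : 0 < r by rewrite !lt_min d0 x0 subr_gt0.
  apply/nbhs_ballP; exists r => //= h; rewrite /ball/= sub0r normrN => hr h0.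
  rewrite /GRing.scale/= mulr1.
  have : `|h| < d by apply: lt_le_trans hr _; rewrite ge_min lexx.
  have : `|h| < x.
    by apply: lt_le_trans hr _; rewrite !ge_min lexx orbT.
  have : `|h| < 1 - x.
    by apply: lt_le_trans hr _; rewrite !ge_min lexx !orbT.
  rewrite !ltr_norml => /andP[h1 h2] /andP[h3 h4] /andP[h5 h6].
  have hx01 : h + x \in `[0, 1] by rewrite in_itv/=; apply/andP; split; lra.
  have := Hd (h + x) hx01; rewrite addrK => /(_ _).
  rewrite ltr_norml h5 h6 => /(_ isT) hh.
  rewrite -(ler_pM2r (_ : 0 < `|h|)) ?normr_gt0//; apply: le_trans hh.
  by rewrite -normrM mulrBl mulrAC mulVf// mul1r distrC.
have dv : derivable f x 1 by apply/cvg_ex; exists (g x).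
by apply: DeriveDef => //; apply/cvg_lim.
Qed.

Lemma increment01_continuous f g x y : increment01 f g -> 0 <= x -> x < y ->
  y <= 1 -> {within `[x, y], continuous f}.
Proof.
move=> H x0 xy y1.
have cont z : z \in `[0, 1] -> forall e, 0 < e ->
    exists2 d, 0 < d & forall t, t \in `[0, 1] -> `|t - z| < d -> `|f z - f t| <= e.
  move=> z01 e e0; have [d d0 Hd] := H z z01 1 ltr01.
  have c0 : 0 < 1 + `|g z| by rewrite ltr_wpDr.
  exists (Num.min d (e / (1 + `|g z|))) => [|t t01].
    by rewrite lt_min d0 divr_gt0.
  rewrite lt_min => /andP[td te].
  have {Hd}h := Hd t t01 td.
  rewrite distrC (_ : f t - f z = (f t - f z - g z * (t - z)) + g z * (t - z)); last by ring.
  apply: le_trans (ler_normD _ _) _; rewrite normrM.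
  apply: (@le_trans _ _ ((1 + `|g z|) * `|t - z|)).
    by rewrite mulrDl lerD2r.
  by move: te; rewrite ltr_pdivlMr// mulrC => /ltW.
apply/continuous_within_itvP => //; split.
- move=> z; rewrite in_itv/= => /andP[xz zy].
  apply/cvgrPdist_le => e e0.
  have z01 : z \in `[0, 1] by rewrite in_itv/=; apply/andP; split; lra.
  have [d d0 Hd] := cont z z01 e e0.
  pose r := Num.min d (Num.min (z - x) (y - z)).
  have r0 : 0 < r by rewrite !lt_min d0 !subr_gt0 xz.
  apply/nbhs_ballP; exists r => //= t; rewrite /ball/= distrC !lt_min !ltr_norml.
  move=> /and3P[/andP[t1 t2] /andP[t3 t4] /andP[t5 t6]].
  apply: Hd; last by rewrite ltr_norml t1.
  by rewrite in_itv/=; apply/andP; split; lra.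
- apply/cvgrPdist_le => e e0.
  have z01 : x \in `[0, 1] by rewrite in_itv/=; apply/andP; split; lra.
  have [d d0 Hd] := cont x z01 e e0.
  pose r := Num.min d (y - x).
  have r0 : 0 < r by rewrite !lt_min d0 !subr_gt0 xy.
  apply/nbhs_ballP; exists r => //= t; rewrite /ball/= distrC !lt_min !ltr_norml.
  move=> /andP[/andP[t1 t2] /andP[t3 t4]] xt.
  apply: Hd; last by rewrite ltr_norml t1.
  by rewrite in_itv/=; apply/andP; split; lra.
- apply/cvgrPdist_le => e e0.
  have z01 : y \in `[0, 1] by rewrite in_itv/=; apply/andP; split; lra.
  have [d d0 Hd] := cont y z01 e e0.
  pose r := Num.min d (y - x).
  have r0 : 0 < r by rewrite !lt_min d0 !subr_gt0 xy.
  apply/nbhs_ballP; exists r => //= t; rewrite /ball/= distrC !lt_min !ltr_norml.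
  move=> /andP[/andP[t1 t2] /andP[t3 t4]] xt.
  apply: Hd; last by rewrite ltr_norml t1.
  by rewrite in_itv/=; apply/andP; split; lra.
Qed.

Lemma increment01_MVT f g x y : increment01 f g -> 0 <= x -> x < y -> y <= 1 ->
  exists2 c, x <= c <= y & f y - f x = g c * (y - x).
Proof.
move=> H x0 xy y1.
have dv z : z \in `]x, y[ -> is_derive z 1 f (g z).
  rewrite in_itv/= => /andP[xz zy].
  by apply: (increment01_is_derive H); rewrite in_itv/=; apply/andP; split; lra.
have [c cxy E] := MVT xy dv (increment01_continuous H x0 xy y1).
exists c => //.
by move: cxy; rewrite in_itv/= => /andP[/ltW -> /ltW ->].
Qed.

Lemma increment01_MVTsym f g x y : increment01 f g ->
  x \in `[0, 1] -> y \in `[0, 1] ->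
  exists c, [/\ c \in `[0, 1], `|c - x| <= `|y - x| & f y - f x = g c * (y - x)].
Proof.
move=> H x01 y01; move: (x01) (y01); rewrite !in_itv/= => /andP[x0 x1] /andP[y0 y1].
have [xy|yx|->] := ltgtP x y.
- have [c /andP[xc cy] E] := increment01_MVT H x0 xy y1.
  exists c; split => //; first by rewrite in_itv/=; apply/andP; split; lra.
  by rewrite !ger0_norm; lra.
- have [c /andP[xc cy] E] := increment01_MVT H y0 yx x1.
  exists c; split => //; first by rewrite in_itv/=; apply/andP; split; lra.
    by rewrite !ler0_norm; lra.
  by rewrite -opprB E; ring.
- by exists y; rewrite !subrr mulr0.
Qed.

Lemma is_derive_increment01 f g : (forall x, is_derive x 1 f (g x)) ->
  increment01 f g.
Proof.
move=> H x x01 e e0.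
have [dv gx] := H x.
have : h^-1 *: (f (h *: 1 + x) - f x) @[h --> 0^'] --> g x.
  by rewrite -gx; exact: dv.
move=> /cvgrPdist_le/(_ _ e0) /nbhs_ballP[d /= d0 Hd]; exists d => // y y01 yx.
have [->|yNx] := eqVneq y x; first by rewrite !subrr mulr0 subrr normr0 mulr0.
have yx0 : y - x != 0 by rewrite subr_eq0.
have := Hd (y - x); rewrite /ball/= sub0r normrN => /(_ yx yx0).
rewrite /GRing.scale/= mulr1 subrK.
rewrite -(ler_pM2r (_ : 0 < `|y - x|)) ?normr_gt0//; apply: le_trans.
by rewrite -normrM mulrBl mulrAC mulVf// mul1r distrC.
Qed.

Lemma increment01B f1 g1 f2 g2 : increment01 f1 g1 -> increment01 f2 g2 ->
  increment01 (fun x => f1 x - f2 x) (fun x => g1 x - g2 x).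
Proof.
move=> H1 H2 x x01 e e0; have e20 : 0 < e / 2 by rewrite divr_gt0.
have [d1 d10 Hd1] := H1 x x01 _ e20.
have [d2 d20 Hd2] := H2 x x01 _ e20.
exists (Num.min d1 d2) => [|y y01]; first by rewrite lt_min d10.
rewrite lt_min => /andP[yd1 yd2].
have := Hd1 y y01 yd1; have := Hd2 y y01 yd2.
set a := _ - _ - _; set b := _ - _ - _ => ha hb.
rewrite [X in `|X|](_ : _ = b - a); last by rewrite /a /b; ring.
by apply: le_trans (ler_normB _ _) _; lra.
Qed.

Lemma increment01_horner (p : {poly R}) :
  increment01 (horner p) (horner p^`()).
Proof.
by apply: is_derive_increment01.
Qed.

Lemma poly_antiderivative (p : {poly R}) (x y : R) : exists q : {poly R},
  [/\ q^`() = p, (size q <= (size p).+1)%N & q.[x] = y].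
Proof.
pose q0 : {poly R} := \poly_(i < (size p).+1) (p`_i.-1 / i%:R).
exists (q0 + (y - q0.[x])%:P); split.
- rewrite derivD derivC addr0; apply/polyP => i.
  rewrite coef_deriv coef_poly/= ltnS.
  case: ltnP => [ip|pi]; last by rewrite mul0rn nth_default.
  by rewrite -[LHS]mulr_natr divfK// pnatr_eq0.
- rewrite (leq_trans (size_polyD _ _))// geq_max size_poly/=.
  by rewrite (leq_trans (size_polyC_leq1 _)).
- by rewrite hornerD hornerC addrC subrK.
Qed.

(** By induction on [k]: the derivative is close to a polynomial, an
    antiderivative of that polynomial with the value of the function at [x0] is
    taken, and the mean value theorem gains one power of the distance. *)
Lemma holder_taylor (k : nat) (a L x0 : R) (D : nat -> R -> R) :
  0 < a -> 0 <= L -> x0 \in `[0, 1] ->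
  (forall j, (j < k)%N -> increment01 (D j) (D j.+1)) ->
  (forall y, y \in `[0, 1] -> `|D k x0 - D k y| <= L * `|x0 - y| `^ a) ->
  exists2 p : {poly R}, (size p <= k.+1)%N &
    forall y, y \in `[0, 1] -> `|D 0%N y - p.[y]| <= L * `|y - x0| `^ (a + k%:R).
Proof.
move=> a0 L0 x01; elim: k D => [|k IH] D HD Hk.
  exists (D 0%N x0)%:P; first exact: size_polyC_leq1.
  by move=> y y01; rewrite hornerC distrC addr0 distrC -(distrC x0) distrC; exact: Hk.
have [p sp Hp] := IH (fun j => D j.+1) (fun j jk => HD j.+1 jk) Hk.
have [q [qp sq qx]] := poly_antiderivative p x0 (D 0%N x0).
exists q; first exact: leq_trans sq _.
move=> y y01.
have := increment01B (HD 0%N isT) (increment01_horner q).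
move=> /increment01_MVTsym/(_ x01 y01)[c [c01 cxy]].
rewrite qx subrr subr0 => ->; rewrite qp normrM.
have [->|yx] := eqVneq y x0; first by rewrite subrr normr0 mulr0 mulr_ge0 ?powR_ge0.
have yx0 : 0 < `|y - x0| by rewrite normr_gt0 subr_eq0.
rewrite -natr1 addrA powRD; last by rewrite (gt_eqF yx0) implybT.
rewrite powRr1// mulrA ler_wpM2r//.
apply: le_trans (Hp c c01) _; rewrite ler_wpM2l// ge0_ler_powR// ?nnegrE//.
by rewrite addr_ge0// ltW.
Qed.

End derivative01.

(** * Regularity of bounded functions of the class and finite differences *)

Section holder.
Context {R : realType}.
Implicit Types (f : R -> R) (D : nat -> R -> R).

(** A bounded function cannot have a large derivative on a whole interval: take
    a point in each of the outer thirds where the previous derivative is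
    bounded, and apply the mean value theorem between them. *)
Lemma derivative_small_somewhere (k : nat) (w : R) : 0 < w ->
  exists2 C, 0 <= C & forall D a, 0 <= a -> a + w <= 1 ->
    (forall j, (j < k)%N -> increment01 (D j) (D j.+1)) ->
    (forall x, x \in `[0, 1] -> `|D 0%N x| <= 1) ->
    exists2 z, a <= z <= a + w & `|D k z| <= C.
Proof.
elim: k w => [|k IH] w w0.
  exists 1 => // D a a0 aw _ D0; exists a; first by rewrite lexx lerDl ltW.
  by apply: D0; rewrite in_itv/= a0/=; lra.
have w30 : 0 < w / 3 by lra.
have [C C0 HC] := IH _ w30.
exists (2 * C / (w / 3)) => [|D a a0 aw HD D0].
  by rewrite divr_ge0 ?mulr_ge0//; exact: ltW.
have HD' j : (j < k)%N -> increment01 (D j) (D j.+1).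
  by move=> jk; apply: HD; exact: ltnW.
have [x /andP[x1 x2] Dx] := HC D a a0 ltac:(lra) HD' D0.
have [y /andP[y1 y2] Dy] := HC D (a + 2 * w / 3) ltac:(lra) ltac:(lra) HD' D0.
have x0 : 0 <= x by lra.
have xy : x < y by lra.
have y11 : y <= 1 by lra.
have [z /andP[xz zy] E] := increment01_MVT (HD k (leqnn _))
  x0 xy y11.
exists z; first by apply/andP; split; lra.
have yx0 : 0 < y - x by lra.
rewrite -(ler_pM2r yx0) -[in leLHS](gtr0_norm yx0) -normrM -E.
apply: le_trans (ler_normB _ _) _; apply: (@le_trans _ _ (2 * C)); first lra.
by rewrite mulrAC ler_pdivlMr// ler_wpM2l ?mulr_ge0//; lra.
Qed.

(** Downward from the top derivative: each derivative is bounded at some point,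
    and its oscillation is controlled by the bound on the next one (by
    hypothesis for the top one). *)
Lemma derivatives_bounded (k : nat) (L : R) : 0 <= L ->
  forall i, (i <= k)%N ->
  exists2 C, 0 <= C & forall D,
    (forall j, (j < k)%N -> increment01 (D j) (D j.+1)) ->
    (forall x, x \in `[0, 1] -> `|D 0%N x| <= 1) ->
    (forall x y, x \in `[0, 1] -> y \in `[0, 1] -> `|D k x - D k y| <= L) ->
    forall x, x \in `[0, 1] -> `|D (k - i)%N x| <= C.
Proof.
move=> L0; elim=> [|i IH] ik.
  have [C C0 HC] := derivative_small_somewhere k ltr01.
  exists (C + L) => [|D HD D0 DL x x01]; first exact: addr_ge0.
  have [z zz Dz] := HC D 0 (lexx _) ltac:(lra) HD D0.
  have z01 : z \in `[0, 1] by rewrite in_itv/= -[1]add0r.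
  rewrite subn0 (_ : D k x = D k z + (D k x - D k z)); last by ring.
  by apply: le_trans (ler_normD _ _) _; apply: lerD => //; exact: DL.
have [C C0 HC] := IH (ltnW ik).
have [C' C'0 HC'] := derivative_small_somewhere (k - i.+1) ltr01.
exists (C' + C) => [|D HD D0 DL x x01]; first exact: addr_ge0.
have HD' j : (j < k - i.+1)%N -> increment01 (D j) (D j.+1).
  by move=> jk; apply: HD; rewrite (leq_trans jk)// leq_subr.
have [z zz Dz] := HC' D 0 (lexx _) ltac:(lra) HD' D0.
have z01 : z \in `[0, 1] by rewrite in_itv/= -[1]add0r.
have kiS : (k - i = (k - i.+1).+1)%N by rewrite subnSK.
have kik : (k - i.+1 < k)%N by rewrite -kiS leq_subr.
have [c [c01 _ E]] := increment01_MVTsym (HD _ kik) z01 x01.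
rewrite -[D _ x](subrK (D (k - i.+1)%N z)) addrC.
apply: le_trans (ler_normD _ _) _; apply: lerD => //.
rewrite E normrM -[leRHS]mulr1 ler_pM//; first by rewrite -kiS; exact: HC.
move: x01 z01; rewrite !in_itv/= ler_norml => /andP[? ?] /andP[? ?].
by apply/andP; split; lra.
Qed.

Lemma powR_le1 (x a : R) : 0 <= x <= 1 -> 0 <= a -> x `^ a <= 1.
Proof.
move=> /andP[x0 x1] a0; rewrite (_ : 1 = 1 `^ a); last by rewrite powR1.
by rewrite ge0_ler_powR// nnegrE.
Qed.

Lemma norm_sub01 (x y : R) : x \in `[0, 1] -> y \in `[0, 1] -> `|x - y| <= 1.
Proof.
rewrite !in_itv/= ler_norml => /andP[? ?] /andP[? ?].
by apply/andP; split; lra.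
Qed.

(** If the order exceeds one, smoothness alone allows lines of any slope; the
    bounds on [f] itself are what makes the modulus uniform over the class. *)
Lemma bounded_holder_modulus (beta L h : R) : 0 < beta -> 0 < L -> 0 < h ->
  exists2 C, 0 <= C & forall f, bounded_holder_class h beta L f ->
    forall x y, x \in `[0, 1] -> y \in `[0, 1] ->
      `|f x - f y| <= C * `|x - y| `^ (Num.min 1 beta).
Proof.
move=> b0 L0 h0.
have [kb bk] := andP (smoothness_orderP b0).
set k := smoothness_order beta in kb bk *.
have a0 : 0 < beta - k%:R by rewrite subr_gt0.
have [k0|k0] := posnP k.
  exists L => [|f [[D [D0 _ DL]] _] x y x01 y01]; first exact: ltW.
  have := DL x y x01 y01; rewrite -/k k0 D0 subr0.
  rewrite min_r//; by move: bk; rewrite k0.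
have [C C0 HC] := derivatives_bounded (ltW L0) (leq_pred k).
exists C => // f [[D [D0 HD DL]] fh] x y x01 y01.
have HD' j : (j < k)%N -> increment01 (D j) (D j.+1).
  by move=> jk; apply/has_derivative01P/HD.
have [c [c01 _ E]] := increment01_MVTsym (HD' _ k0) y01 x01.
have k1b : 1 <= beta.
  by apply: le_trans (ltW kb); rewrite -[1]/(1%:R) ler_nat.
rewrite min_l// powRr1// -D0 E normrM ler_wpM2r//.
have := HC D HD' _ _ c c01; rewrite -subn1 subKn//; apply.
- move=> z z01; rewrite D0 ler_norml; have /andP[hz ->] := fh z z01.
  by rewrite andbT (le_trans _ hz)//; lra.
- move=> u v u01 v01; apply: le_trans (DL u v u01 v01) _.
  by rewrite ler_piMr ?(ltW L0)// powR_le1 ?normr_ge0 ?norm_sub01// ltW.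
Qed.

(** The signed binomial coefficients of the [M]-th finite difference, taken as
    coefficients of a power so that Pascal's rule is multiplication by
    [1 - X]. *)
Definition diff_weight (M j : nat) : R := ((1 - 'X) ^+ M)`_j.

Lemma diff_weight0 M : diff_weight M 0 = 1.
Proof.
by rewrite /diff_weight -horner_coef0 horner_exp !hornerE subr0 expr1n.
Qed.

Lemma size_diff_poly M : (size ((1 - 'X : {poly R}) ^+ M) <= M.+1)%N.
Proof.
rewrite (leq_trans (size_poly_exp_leq _ _))// ltnS.
rewrite -[leqRHS]mul1n leq_mul2r; apply/orP; right.
rewrite -opprB size_polyN.
by rewrite -[1]/(1%:P) size_XsubC.
Qed.

(** One difference lowers the degree by one, because translation keeps the
    leading coefficient. *)
Lemma diff_weight_annihilates M (q : {poly R}) (x t : R) : (size q <= M)%N ->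
  \sum_(j < M.+1) diff_weight M j * q.[x + j%:R * t] = 0.
Proof.
elim: M q x => [|M IH] q x sq.
  by rewrite (size_poly_leq0P _ sq) big1// => i _; rewrite horner0 mulr0.
pose Dq := q - (q \Po ('X + t%:P)).
have sDq : (size Dq <= M)%N.
  have sXt : size ('X + t%:P) = 2 by rewrite size_XaddC.
  have sqc : (size (q \Po ('X + t%:P)) <= M.+1)%N by rewrite size_comp_poly2.
  apply/leq_sizeP => j; rewrite leq_eqVlt => /predU1P[<-|Mj]; last first.
    by rewrite /Dq coefB !nth_default ?subrr// (leq_trans _ Mj).
  have [sqM|sqM] := leqP (size q) M.
    by rewrite /Dq coefB !nth_default ?subrr// size_comp_poly2.
  have sqE : size q = M.+1 by apply/eqP; rewrite eqn_leq sq.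
  have s1 : (1 < size ('X + t%:P)%R)%N by rewrite sXt.
  have := lead_coef_comp q s1.
  rewrite /lead_coef size_comp_poly2// sqE/= coefB => ->.
  by rewrite -/(lead_coef _) lead_coefXaddC expr1n mulr1 subrr.
rewrite -[RHS](IH Dq x sDq).
have wS j : diff_weight M.+1 j.+1 = diff_weight M j.+1 - diff_weight M j.
  by rewrite /diff_weight exprS mulrBl mul1r coefB coefXM.
have wM : diff_weight M M.+1 = 0.
  by rewrite /diff_weight nth_default// size_diff_poly.
have DqE y : Dq.[y] = q.[y] - q.[y + t].
  by rewrite /Dq hornerD hornerN horner_comp !hornerE.
transitivity (\sum_(j < M.+2) diff_weight M j * q.[x + j%:R * t] -
    \sum_(j < M.+1) diff_weight M j * q.[x + j.+1%:R * t]).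
  rewrite big_ord_recl [X in _ = X - _]big_ord_recl !diff_weight0 -addrA.
  congr (_ + _); rewrite -sumrB.
  apply: eq_bigr => j _.
  by rewrite /= wS mulrBl.
rewrite big_ord_recr/= wM mul0r addr0 -sumrB; apply: eq_bigr => j _.
by rewrite DqE mulrBr -natr1 mulrDl mul1r addrA.
Qed.

Definition diff_weight_norm M : R := \sum_(j < M.+1) `|diff_weight M j|.

(** The squared function is not handled as a Holder function.  With [f = p + r],
    [p] the Taylor polynomial, [f^2 = p^2 + r (2 f - r)]; differences of order
    [2 k + 1] annihilate [p^2], of degree at most [2 k], and the rest is of
    the size of [r] because [f] is bounded. *)
Lemma holder_square_difference (beta L h : R) : 0 < beta -> 0 < L -> 0 < h ->
  let M := (smoothness_order beta).*2.+1 in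
  exists2 C, 0 <= C & forall f, bounded_holder_class h beta L f ->
    forall x t, `|t| <= 1 ->
      (forall j, (j <= M)%N -> x + j%:R * t \in `[0, 1]) ->
      `|\sum_(j < M.+1) diff_weight M j * f (x + j%:R * t) ^+ 2| <= C * `|t| `^ beta.
Proof.
move=> b0 L0 h0 M.
have [kb bk] := andP (smoothness_orderP b0).
set k := smoothness_order beta in M kb bk *.
have a0 : 0 < beta - k%:R by rewrite subr_gt0.
pose B := L * M%:R `^ beta.
have B0 : 0 <= B by rewrite mulr_ge0 ?powR_ge0// ltW.
exists (diff_weight_norm M * (B * (2 + B))) => [|f [[D [D0 HD DL]] fh] x t t1 xt].
  by rewrite mulr_ge0// ?sumr_ge0// mulr_ge0// addr_ge0.
have x01 : x \in `[0, 1] by have := xt 0%N isT; rewrite mul0r addr0.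
have HD' j : (j < k)%N -> increment01 (D j) (D j.+1).
  by move=> jk; apply/has_derivative01P/HD.
have [p sp Hp] := holder_taylor a0 (ltW L0) x01 HD' (fun y y01 => DL x y x01 y01).
have sp2 : (size (p ^+ 2) <= M)%N.
  rewrite expr2 (leq_trans (size_polyMleq _ _))//.
  by rewrite /M -addnn; lia.
have := diff_weight_annihilates x t sp2 => annih.
rewrite -[X in `|X|]subr0 -[X in _ - X]annih -sumrB.
apply: le_trans (ler_norm_sum _ _ _) _.
rewrite -mulrA mulr_suml; apply: ler_sum => j _.
rewrite -mulrBr normrM ler_wpM2l//.
have y01 := xt j (ltn_ord j); set y := x + _ in y01 *.
have := Hp y y01; rewrite D0 subrK /y addrAC subrr add0r => r1.
rewrite horner_exp -/y; rewrite -/y in r1; move: r1; set r := f y - p.[y] => r1.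
have rB : `|r| <= B * `|t| `^ beta.
  apply: le_trans r1 _; rewrite normrM normr_nat powRM// mulrA ler_wpM2r ?powR_ge0//.
  rewrite ler_wpM2l ?(ltW L0)// ge0_ler_powR ?nnegrE ?(ltW b0)// ler_nat.
  by rewrite -ltnS.
have rB' : `|r| <= B.
  by apply: le_trans rB _; rewrite ler_piMr// powR_le1 ?normr_ge0// ltW.
have f1 : `|f y| <= 1.
  rewrite ler_norml; have /andP[hz ->] := fh y y01.
  by rewrite andbT (le_trans _ hz)//; lra.
rewrite (_ : _ - _ = r * (2 * f y - r)); last by rewrite /r; ring.
rewrite normrM mulrAC ler_pM//.
apply: le_trans (ler_normB _ _) _; rewrite normrM ger0_norm//; lra.
Qed.

End holder.

(** * Loss of step estimators and exponential moments of block sums *)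

Section piecewise_estimator.
Context d (T : measurableType d) (R : realType).

(** The supremum runs over uncountably many points, but for an estimator with
    finitely many random values a superlevel set of the loss is a finite union of
    preimages of open sets. *)
Lemma measurable_piecewise_loss n (v : 'I_n -> T -> R) (cell : R -> 'I_n)
    (f : R -> R) : (forall i, measurable_fun setT (v i)) ->
  measurable_fun setT (fun y => sup_norm01 (fun x => f x - v (cell x) y)).
Proof.
move=> mv; apply: (measurability _ (ErealGenOInfty.measurableE R)) => //.
move=> _ [_ [r ->] <-]; rewrite setTI.
pose far i : set R := \bigcup_(x in [set x | x \in `[0, 1] /\ cell x = i])
  [set u | r < `|f x - u|].
rewrite (_ : _ @^-1` _ = \bigcup_i (v i @^-1` far i)); last first.
  apply/seteqP; split => y /=; rewrite in_itv/= andbT.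
    move=> /ereal_sup_gt[_ [x /= x01 <-]]; rewrite lte_fin => rx.
    by exists (cell x) => //; exists x.
  move=> [i _ [x /= [x01 <-]] rx].
  apply: (@lt_le_trans _ _ `|f x - v (cell x) y|%:E); first by rewrite lte_fin.
  by apply: ereal_sup_ubound; exists x.
apply: fin_bigcup_measurable => // i _.
rewrite -[X in measurable X]setTI; apply: mv => //.
apply: open_measurable; apply: bigcup_open => x _.
rewrite (_ : [set u | _] = (fun u => `|f x - u|) @^-1` [set z | r < z])//.
apply: open_comp; last exact: open_gt.
move=> u _; apply: cvg_norm; apply: cvgB; [exact: cvg_cst|exact: cvg_id].
Qed.

End piecewise_estimator.

Section block_deviation.
Context (R : realType) (n : nat) (s : R) (N : noise_model n s).
Hypothesis s0 : 0 <= s.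
Local Notation P := (noise_prob N).
Variable f : R -> R.
Hypothesis f01 : forall i : 'I_n, 0 < f (i.+1%:R / n%:R) <= 1.

(** By independence the exponential moment factors, and every factor is bounded
    by [integral_normal_expR_centered] since all variances are at most
    [1 + s^2]. *)
Lemma block_exponential_moment (J : {set 'I_n}) (l : R) :
  `|l| * (1 + s ^+ 2) <= 1 / 8 ->
  (\int[P]_w (expR (l * \sum_(i in J)
      (tnth (observation (N := N) f w) i ^+ 2 - obs_var s f i)))%:E <=
   (expR (2 * #|J|%:R * (l * (1 + s ^+ 2)) ^+ 2))%:E)%E.
Proof.
move=> lv.
have f0 (i : 'I_n) : 0 < f (i.+1%:R / n%:R) by have /andP[] := f01 i.
have v0 (i : 'I_n) : 0 < obs_var s f i.
  by rewrite /obs_var ltr_pwDl ?exprn_gt0 ?sqr_ge0//.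
have vle (i : 'I_n) : obs_var s f i <= 1 + s ^+ 2.
  have /andP[f0i f1i] := f01 i.
  by rewrite lerD2r exprn_ile1// ltW.
have lvi (i : 'I_n) : `|l| * obs_var s f i <= 1 / 8.
  by apply: le_trans lv; rewrite ler_wpM2l.
pose g (i : 'I_n) (y : R) : R :=
  if i \in J then expR (l * (y ^+ 2 - obs_var s f i)) else 1.
have mg i : measurable_fun setT (g i).
  rewrite /g; case: (i \in J) => //.
  apply: measurableT_comp => //; apply: measurable_funM => //.
  exact: measurable_funB.
have g0 i y : 0 <= g i y by rewrite /g; case: ifP => // _; exact: expR_ge0.
pose b (i : 'I_n) : R := if i \in J then expR (2 * (l * (1 + s ^+ 2)) ^+ 2) else 1.
have gb i : (\int[normal_prob 0 (Num.sqrt (obs_var s f i))]_y (g i y)%:E <= (b i)%:E)%E.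
  rewrite /g /b; case: (i \in J); last first.
    by rewrite integral_cst// mul1e; exact: probability_le1.
  apply: le_trans (integral_normal_expR_centered (v0 i) (lvi i)) _.
  rewrite lee_fin ler_expR ler_pM2l// !exprMn ler_wpM2l ?sqr_ge0//.
  by rewrite lerXn2r// nnegrE ?addr_ge0 ?sqr_ge0// ltW.
have gfin i : (\int[normal_prob 0 (Num.sqrt (obs_var s f i))]_y (g i y)%:E)%E \is a fin_num.
  rewrite ge0_fin_numE; first exact: le_lt_trans (gb i) (ltry _).
  by apply: integral_ge0 => y _; rewrite lee_fin.
rewrite [leLHS](_ : _ = \int[P]_w (\prod_i g i (tnth (observation (N := N) f w) i))%:E)%E; last first.
  apply: eq_integral => w _; congr EFin.
  rewrite mulr_sumr expR_sum big_mkcond/=; apply: eq_bigr => i _.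
  by rewrite /g; case: ifP.
rewrite integral_prod_observation//.
apply: (@le_trans _ _ (\prod_i (b i)%:E)%E).
  apply: lee_prod => i; rewrite gb andbT.
  by apply: integral_ge0 => y _; rewrite lee_fin.
rewrite prodEFin lee_fin /b -big_mkcond/= prodr_const -expRM_natl.
by rewrite mulrCA mulrA.
Qed.

End block_deviation.

(** * Local finite-difference estimator of the squared function *)

Section estimator.
Context {R : realType}.
Variables (n S M : nat) (s h : R).
Hypotheses (S0 : (0 < S)%N) (M0 : (0 < M)%N).
Hypothesis MS : ((M * S).*2 <= n)%N.
Implicit Types (i : 'I_n.+1) (y : n.+1.-tuple R) (f : R -> R).

(** Steps go to the right from the left half of the design and to the left from
    its right half, so that they never leave it. *)
Definition block_index (i j t : nat) : nat :=
  if (i.+1.*2 <= n.+1)%N then (i + j * t)%N else (i - j * t)%N.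

Definition block_sign (i : nat) : R := if (i.+1.*2 <= n.+1)%N then 1 else -1.

Definition design (i : nat) : R := i.+1%:R / n.+1%:R.

Lemma design01 i : design i \in `[0, 1].
Proof. by rewrite in_itv/= divr_ge0//= ler_pdivrMr ?ltr0n// mul1r ler_nat. Qed.

Lemma block_mul_le (j t : nat) : (j <= M)%N -> (t <= S)%N -> (j * t <= M * S)%N.
Proof. exact: leq_mul. Qed.

Lemma block_index_lt i (j t : nat) : (j <= M)%N -> (t <= S)%N ->
  (block_index i j t < n.+1)%N.
Proof.
move=> jM tS; have := block_mul_le jM tS; have := ltn_ord i.
by rewrite /block_index; case: ifP; lia.
Qed.

Lemma design_block_index i (j t : nat) : (j <= M)%N -> (t <= S)%N ->
  design (block_index i j t) = design i + j%:R * (block_sign i * t%:R / n.+1%:R).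
Proof.
move=> jM tS; have := block_mul_le jM tS; have := ltn_ord i.
rewrite /block_index /block_sign /design; case: ifPn => c1 ilt jt.
  by rewrite -addSn natrD natrM mul1r mulrDl mulrA.
have jti : (j * t <= i)%N by lia.
by rewrite -subSn// natrB ?(leq_trans jti)// natrM mulrBl; ring.
Qed.

Definition block_pos i (j t : nat) : 'I_n.+1 := inord (block_index i j t).

Definition block i (j : nat) : {set 'I_n.+1} :=
  [set block_pos i j t.+1 | t : 'I_S].

Lemma block_pos_inj i (j : nat) : (0 < j <= M)%N ->
  injective (fun t : 'I_S => block_pos i j t.+1).
Proof.
move=> /andP[j0 jM] t1 t2 /(congr1 val) /=.
have l1 := block_index_lt i jM (ltn_ord t1).
have l2 := block_index_lt i jM (ltn_ord t2).
rewrite !inordK// /block_index => E; apply/val_inj => /=.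
have := block_mul_le jM (ltn_ord t1); have := block_mul_le jM (ltn_ord t2).
have := ltn_ord i; move: E; case: ifP => c E ilt m1 m2.
  suff : (j * t1.+1 = j * t2.+1)%N by move/eqP; rewrite eqn_pmul2l// => /eqP[].
  lia.
suff : (j * t1.+1 = j * t2.+1)%N by move/eqP; rewrite eqn_pmul2l// => /eqP[].
lia.
Qed.

Lemma card_block i (j : nat) : (0 < j <= M)%N -> #|block i j| = S.
Proof. by move=> jM; rewrite card_imset ?card_ord//; exact: block_pos_inj. Qed.

Lemma sum_block i (j : nat) (phi : 'I_n.+1 -> R) : (0 < j <= M)%N ->
  \sum_(l in block i j) phi l = \sum_(t < S) phi (block_pos i j t.+1).
Proof.
by move=> jM; rewrite big_imset//= => t1 t2 _ _; exact: block_pos_inj.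
Qed.

Definition block_deviation f i (j : nat) y : R :=
  S%:R^-1 * \sum_(l in block i j) (tnth y l ^+ 2 - obs_var s f l).

(** A finite difference of [f^2] nearly vanishes, and its coefficient at the base
    point is 1: minus the other terms is an approximation of [f^2] at the base
    point.  Averaging over the steps [1, ..., S] brings the noise down. *)
Definition square_estimator i y : R :=
  - \sum_(j < M) diff_weight M j.+1 *
      (S%:R^-1 * \sum_(l in block i j.+1) (tnth y l ^+ 2 - s ^+ 2)).

(** The first term is the bias, a finite difference of [f^2] for every step; the
    second one is the noise, one block average of centred squares per
    coefficient. *)
Lemma square_estimator_error f i y (C beta : R) : 0 <= C -> 0 <= beta ->
  (forall x t, `|t| <= 1 ->
      (forall j, (j <= M)%N -> x + j%:R * t \in `[0, 1]) ->
      `|\sum_(j < M.+1) diff_weight M j * f (x + j%:R * t) ^+ 2| <= C * `|t| `^ beta) ->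
  `|square_estimator i y - f (design i) ^+ 2| <=
  C * (S%:R / n.+1%:R) `^ beta +
  \sum_(j < M) `|diff_weight M j.+1| * `|block_deviation f i j.+1 y|.
Proof.
move=> C0 b0 Hf.
pose tau (t : 'I_S) : R := block_sign i * t.+1%:R / n.+1%:R.
have S00 : S%:R != 0 :> R by rewrite pnatr_eq0 -lt0n.
have E : square_estimator i y - f (design i) ^+ 2 =
    - (S%:R^-1 * \sum_(t < S)
        \sum_(j < M.+1) diff_weight M j * f (design i + j%:R * tau t) ^+ 2)
    - \sum_(j < M) diff_weight M j.+1 * block_deviation f i j.+1 y.
  rewrite /square_estimator.
  have -> : \sum_(t < S)
        \sum_(j < M.+1) diff_weight M j * f (design i + j%:R * tau t) ^+ 2 =
      S%:R * f (design i) ^+ 2 + \sum_(j < M) diff_weight M j.+1 *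
        \sum_(l in block i j.+1) f (design l) ^+ 2.
    under eq_bigr do rewrite big_ord_recl/= diff_weight0 mul1r mul0r addr0.
    rewrite big_split/= sumr_const card_ord mulr_natl; congr (_ + _).
    rewrite exchange_big/=; apply: eq_bigr => j _.
    have jM : (0 < j.+1 <= M)%N by exact: ltn_ord.
    rewrite -mulr_sumr sum_block//; congr (_ * _); apply: eq_bigr => t _.
    rewrite -(design_block_index i jM (ltn_ord t)) /block_pos inordK//.
    exact: block_index_lt.
  rewrite mulrDr mulKf// opprD -[RHS]addrA addrC; congr (_ + _).
  rewrite -opprD; congr (- _); rewrite mulr_sumr -big_split/=.
  apply: eq_bigr => j _; rewrite [X in X + _]mulrCA -mulrDr; congr (_ * _).
  rewrite /block_deviation -mulrDr; congr (_ * _).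
  rewrite -big_split/=; apply: eq_bigr => l _.
  by rewrite /obs_var -/(design l); ring.
rewrite E; apply: le_trans (ler_normB _ _) _; rewrite normrN; apply: lerD.
  rewrite normrM normfV normr_nat ler_pdivrMl ?ltr0n//.
  apply: le_trans (ler_norm_sum _ _ _) _.
  set K := C * _; have -> : S%:R * K = \sum_(t < S) K.
    by rewrite sumr_const card_ord mulr_natl.
  rewrite {}/K; apply: ler_sum => t _.
  have ntau : `|tau t| = t.+1%:R / n.+1%:R.
    rewrite /tau !normrM normfV !normr_nat (_ : `|block_sign i| = 1) ?mul1r//.
    by rewrite /block_sign; case: ifP; rewrite ?normrN normr1.
  have tn : (t.+1 <= n.+1)%N.
    have := ltn_ord t; have : (1 * S <= M * S)%N by rewrite leq_mul2r M0 orbT.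
    lia.
  apply: le_trans (Hf (design i) (tau t) _ _) _.
  - by rewrite ntau ler_pdivrMr ?ltr0n// mul1r ler_nat.
  - move=> j jM; rewrite -design_block_index//.
    have := design01 (Ordinal (block_index_lt i jM (ltn_ord t))); exact.
  rewrite ler_wpM2l// ge0_ler_powR ?nnegrE ?divr_ge0// ntau ler_wpM2r ?invr_ge0//.
  by rewrite ler_nat.
apply: le_trans (ler_norm_sum _ _ _) _.
by apply: ler_sum => j _; rewrite normrM.
Qed.

End estimator.

Section risk_bound.
Context {R : realType}.
Variables (n S M : nat) (s h : R).
Hypotheses (S0 : (0 < S)%N) (M0 : (0 < M)%N).
Hypothesis MS : ((M * S).*2 <= n)%N.
Hypotheses (s0 : 0 <= s) (h0 : 0 < h).
Implicit Types (i : 'I_n.+1) (y : n.+1.-tuple R) (f : R -> R).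

Definition cell (x : R) : 'I_n.+1 := inord (minn (Num.truncn (x * n.+1%:R)) n).

Lemma cell_near (x : R) : x \in `[0, 1] -> `|x - design n (cell x)| <= n.+1%:R^-1.
Proof.
rewrite in_itv/= => /andP[x0 x1].
have xn0 : 0 <= x * n.+1%:R by rewrite mulr_ge0.
have n0 : 0 < n.+1%:R :> R by rewrite ltr0n.
rewrite /design /cell inordK ?ltnS ?geq_minr//.
rewrite -(ler_pM2r n0) mulVf ?gt_eqF// -[X in _ * X <= _](gtr0_norm n0) -normrM.
rewrite mulrBl divfK ?gt_eqF//.
have /andP[t1 t2] := truncn_itv xn0.
set t := Num.truncn _ in t1 t2 *.
have [tn|nt] := leqP t n.
  by rewrite ler_norml; apply/andP; split; rewrite -natr1; lra.
have xn : x * n.+1%:R <= n.+1%:R by rewrite ler_piMl.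
have tn : n.+1%:R <= t%:R :> R by rewrite ler_nat.
by rewrite ler_norml; apply/andP; split; lra.
Qed.

(** The truncation at [h^2] keeps the square root away from its singularity at
    zero, so that an error on [f^2] costs only a constant factor on [f]
    ([sqrt_max_error]). *)
Definition estimator_fun (y : n.+1.-tuple R) (x : R) : R :=
  Num.sqrt (Num.max (h ^+ 2) (square_estimator S M s (cell x) y)).

Lemma sqrt_max_error (a F : R) : h <= a ->
  `|a - Num.sqrt (Num.max (h ^+ 2) F)| <= (2 * h)^-1 * `|F - a ^+ 2|.
Proof.
move=> ha; set b := Num.sqrt _.
have h20 : 0 <= h ^+ 2 by exact: sqr_ge0.
have m0 : 0 <= Num.max (h ^+ 2) F by rewrite le_max h20.
have hb : h <= b.
  rewrite -[leLHS](gtr0_norm h0) -sqrtr_sqr ler_wsqrtr// le_max lexx//.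
have b2 : b ^+ 2 = Num.max (h ^+ 2) F by rewrite sqr_sqrtr.
have hh : 0 < h by [].
clearbody b; have ab0 : 0 < a + b by lra.
have ha2 : h ^+ 2 <= a ^+ 2 by rewrite lerXn2r// nnegrE; lra.
have E : `|b ^+ 2 - a ^+ 2| = `|a - b| * (a + b).
  by rewrite -[X in _ * X](gtr0_norm ab0) -normrM distrC; congr `|_|; ring.
have : `|b ^+ 2 - a ^+ 2| <= `|F - a ^+ 2|.
  rewrite b2; have [hF//|Fh] := lerP (h ^+ 2) F.
  by rewrite !ler0_norm; lra.
rewrite E ler_pdivlMl; last lra.
by move=> H; apply: le_trans H; rewrite mulrC ler_wpM2l//; lra.
Qed.

(** A pointwise form of the Chernoff bound: taking expectations controls the
    mean of a maximum of deviations by a sum of exponential moments, without a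
    separate treatment of the event of large deviations. *)
Lemma norm_le_expR (a l z : R) : 0 <= a -> 0 < l ->
  `|z| <= a + l^-1 * (expR (l * (z - a)) + expR (l * (- z - a))).
Proof.
move=> a0 l0.
have key u : u <= a + l^-1 * expR (l * (u - a)).
  have : l * (u - a) <= expR (l * (u - a)).
    by apply: le_trans (expR_ge1Dx _); lra.
  by rewrite -(ler_pM2l (_ : 0 < l^-1)) ?invr_gt0// mulKf ?gt_eqF//; lra.
have l10 : 0 <= l^-1 by rewrite invr_ge0 ltW.
have e1 := mulr_ge0 l10 (expR_ge0 (l * (z - a))).
have e2 := mulr_ge0 l10 (expR_ge0 (l * (- z - a))).
have := key z; have := key (- z); rewrite [l^-1 * (_ + _)]mulrDr ler_norml => k1 k2.
by apply/andP; split; lra.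
Qed.

Definition exponential_sum f (a l : R) y : R :=
  \sum_(i < n.+1) \sum_(j < M)
    (expR (l * (block_deviation S s f i j.+1 y - a)) +
     expR (l * (- block_deviation S s f i j.+1 y - a))).

Lemma estimator_loss f y (B C beta a l mu : R) :
  0 <= B -> 0 <= C -> 0 <= beta -> 0 <= a -> 0 < l -> 0 <= mu ->
  (forall x, x \in `[0, 1] -> h <= f x <= 1) ->
  (forall x x', x \in `[0, 1] -> x' \in `[0, 1] ->
      `|f x - f x'| <= B * `|x - x'| `^ mu) ->
  (forall x t, `|t| <= 1 ->
      (forall j, (j <= M)%N -> x + j%:R * t \in `[0, 1]) ->
      `|\sum_(j < M.+1) diff_weight M j * f (x + j%:R * t) ^+ 2| <= C * `|t| `^ beta) ->
  (sup_norm01 (fun x => (f x - estimator_fun y x)%R) <=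
   (B * n.+1%:R^-1 `^ mu + (2 * h)^-1 * (C * (S%:R / n.+1%:R) `^ beta +
     diff_weight_norm M * (a + l^-1 * exponential_sum f a l y)))%:E)%E.
Proof.
move=> B0 C0 b0 a0 l0 mu0 fh fmod fsq.
apply: ge_ereal_sup => _ [x /= x01 <-]; rewrite lee_fin.
set i := cell x; have d01 : (design n i : R) \in `[0, 1] by exact: design01.
rewrite (_ : f x - _ = (f x - f (design n i)) + (f (design n i) - estimator_fun y x)); last by ring.
apply: le_trans (ler_normD _ _) _; apply: lerD.
  apply: le_trans (fmod _ _ x01 d01) _; rewrite ler_wpM2l//.
  by rewrite ge0_ler_powR// ?nnegrE ?invr_ge0//; exact: cell_near.
have /andP[hf _] := fh _ d01.
apply: le_trans (sqrt_max_error _ hf) _.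
rewrite ler_wpM2l ?invr_ge0//; first by apply: mulr_ge0 => //; exact: ltW.
apply: le_trans (square_estimator_error s S0 M0 MS i y C0 b0 fsq) _.
rewrite lerD2l.
have term0 i' (j : 'I_M) :
    0 <= expR (l * (block_deviation S s f i' j.+1 y - a)) +
     expR (l * (- block_deviation S s f i' j.+1 y - a)).
  by rewrite addr_ge0 ?expR_ge0.
have Q0 : 0 <= exponential_sum f a l y by do 2 (apply: sumr_ge0 => ? _).
have l10 : 0 <= l^-1 by rewrite invr_ge0 ltW.
have dev (j : 'I_M) : `|block_deviation S s f i j.+1 y| <=
    a + l^-1 * exponential_sum f a l y.
  apply: le_trans (norm_le_expR _ a0 l0) _; rewrite lerD2l ler_wpM2l//.
  rewrite /exponential_sum (bigD1 i)//= (bigD1 j)//= -addrA lerDl.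
  by rewrite addr_ge0// ?sumr_ge0// => *; rewrite sumr_ge0.
rewrite /diff_weight_norm big_ord_recl mulrDl -[leLHS]add0r lerD//.
  by rewrite mulr_ge0// addr_ge0// mulr_ge0.
by rewrite mulr_suml; apply: ler_sum => j _; rewrite ler_wpM2l.
Qed.

Lemma measurable_square_estimator i :
  measurable_fun setT (square_estimator S M s i).
Proof.
rewrite /square_estimator; under eq_fun do rewrite -mulN1r.
apply: measurable_funM => //; apply: measurable_sum_pred => j.
apply: measurable_funM => //; apply: measurable_funM => //.
apply: measurable_sum_pred => l; apply: measurable_funB => //.
by apply: measurable_funX; exact: measurable_tnth.
Qed.

Lemma measurable_estimator_value i :
  measurable_fun setT (fun y => Num.sqrt (Num.max (h ^+ 2) (square_estimator S M s i y))).
Proof.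
apply: measurableT_comp; last first.
  by apply: measurable_maxr => //; exact: measurable_square_estimator.
apply: continuous_measurable_fun; exact: sqrt_continuous.
Qed.

Lemma estimator_fun_estimator (Sigma : set (R -> R)) :
  estimator Sigma (n := n.+1) estimator_fun.
Proof.
split=> [x _|f _]; first exact: measurable_estimator_value.
apply: (measurable_piecewise_loss
  (v := fun i y => Num.sqrt (Num.max (h ^+ 2) (square_estimator S M s i y)))).
exact: measurable_estimator_value.
Qed.

Section model.
Variable N : noise_model n.+1 s.
Local Notation P := (noise_prob N).

Lemma measurable_block_deviation f i (j : nat) :
  measurable_fun setT (block_deviation S s f i j).
Proof.
apply: measurable_funM => //; apply: measurable_sum_pred => l.
apply: measurable_funB => //.
by apply: measurable_funX; exact: measurable_tnth.
Qed.

Lemma expectation_exponential_sum f (a l : R) : 0 < l ->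
  (forall i : 'I_n.+1, 0 < f (i.+1%:R / n.+1%:R) <= 1) ->
  l / S%:R * (1 + s ^+ 2) <= 1 / 8 ->
  (\int[P]_w (exponential_sum f a l (observation (N := N) f w))%:E <=
   (n.+1%:R * M%:R * 2 *
    expR (- l * a + 2 * l ^+ 2 * (1 + s ^+ 2) ^+ 2 / S%:R))%:E)%E.
Proof.
move=> l0 f01 lS.
have S00 : 0 < S%:R :> R by rewrite ltr0n.
have mdev i (j : nat) : measurable_fun setT (fun w =>
    block_deviation S s f i j (observation (N := N) f w)).
  apply: measurableT_comp; first exact: measurable_block_deviation.
  exact: measurable_observation.
have msum (i : 'I_n.+1) (j : nat) : measurable_fun setT (fun w =>
    \sum_(k in block S i j) (tnth (observation (N := N) f w) k ^+ 2 - obs_var s f k)).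
  apply: measurable_sum_pred => k; apply: measurable_funB => //.
  by apply: measurable_funX; exact: measurable_observation_tnth.
pose K := expR (- l * a + 2 * l ^+ 2 * (1 + s ^+ 2) ^+ 2 / S%:R).
pose term (e : R) (i : 'I_n.+1) (j : 'I_M) w :=
  (expR (l * (e * block_deviation S s f i j.+1 (observation (N := N) f w) - a)))%:E.
have mterm e i j : measurable_fun setT (term e i j).
  apply/measurable_EFinP; apply: measurableT_comp => //.
  by apply: measurable_funM => //; apply: measurable_funB => //; apply: measurable_funM.
have term0 e i j w : (0 <= term e i j w)%E by rewrite lee_fin expR_ge0.
have bound (e : R) i j : `|e| = 1 -> (\int[P]_w term e i j w <= K%:E)%E.
  move=> e1.
  rewrite [leLHS](_ : _ = \int[P]_w ((expR (- l * a))%:E *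
     (expR (l * e / S%:R * \sum_(k in block S i j.+1)
      (tnth (observation (N := N) f w) k ^+ 2 - obs_var s f k)))%:E))%E; last first.
    apply: eq_integral => w _; rewrite -EFinM -expRD; congr (expR _)%:E.
    by rewrite /block_deviation; ring.
  rewrite ge0_integralZl ?lee_fin ?expR_ge0//; last first.
    apply/measurable_EFinP; apply: measurableT_comp => //.
    exact: measurable_funM.
  rewrite /K expRD EFinM lee_wpmul2l ?lee_fin ?expR_ge0//.
  apply: le_trans; first apply: block_exponential_moment => //.
    by rewrite !normrM e1 mulr1 normfV !gtr0_norm.
  have jM : (0 < j.+1 <= M)%N by exact: ltn_ord.
  rewrite (card_block S0 M0 MS)// lee_fin ler_expR !exprMn.
  have -> : e ^+ 2 = 1 by rewrite -real_normK ?num_real// e1 expr1n.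
  rewrite le_eqVlt; apply/orP; left; apply/eqP; field; exact: lt0r_neq0.
rewrite [leLHS](_ : _ = \int[P]_w \sum_(i < n.+1) \sum_(j < M)
    (term 1%R i j w + term (-1)%R i j w))%E; last first.
  apply: eq_integral => w _; rewrite /exponential_sum -sumEFin.
  apply: eq_bigr => i _; rewrite -sumEFin; apply: eq_bigr => j _.
  by rewrite EFinD /term mul1r mulN1r.
have mT i j : measurable_fun setT (fun w => term 1%R i j w + term (-1)%R i j w)%E.
  exact: emeasurable_funD.
have mTs i : measurable_fun setT (fun w => \sum_(j < M)
    (term 1%R i j w + term (-1)%R i j w))%E.
  exact: emeasurable_sum.
have T0 i j w : (0 <= term 1%R i j w + term (-1)%R i j w)%E by rewrite adde_ge0.
rewrite ge0_integral_sum//; last by move=> i w _; apply: sume_ge0.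
apply: (@le_trans _ _ (\sum_(i < n.+1) (M%:R * 2 * K)%R%:E)%E).
  apply: lee_sum => i _; rewrite ge0_integral_sum//.
  apply: (@le_trans _ _ (\sum_(j < M) (2 * K)%R%:E)%E).
    apply: lee_sum => j _; rewrite ge0_integralD//.
    rewrite mulr_natl mulr2n EFinD leeD//; first by apply: bound; rewrite normr1.
    by apply: bound; rewrite normrN normr1.
  by rewrite sumEFin sumr_const card_ord -(mulr_natl (2 * K)) mulrA.
by rewrite -/K sumEFin sumr_const card_ord -(mulr_natl (M%:R * 2 * K)) !mulrA.
Qed.

End model.

End risk_bound.

Section minimax_upper.
Context {R : realType}.

Lemma sup_norm01_ge0 (g : R -> R) : (0 <= sup_norm01 g)%E.
Proof.
apply: (@le_trans _ _ `|g 0|%:E); first by rewrite lee_fin.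
by apply: ereal_sup_ubound; exists 0 => //; rewrite /= in_itv/= lexx ler01.
Qed.

(** The three errors are the discretization of [x], the bias and the noise.
    [S] is the number of steps of a block, [a] the deviation that is tolerated
    and [l] the exponent of the Chernoff bound. *)
Lemma minimax_risk_upper (beta L h : R) : 0 < beta -> 0 < L -> 0 < h ->
  let M := (smoothness_order beta).*2.+1 in
  exists B C : R, [/\ 0 <= B, 0 <= C & forall (n S : nat) (s a l : R),
    (0 < S)%N -> ((M * S).*2 <= n)%N -> 0 <= s -> 0 <= a -> 0 < l ->
    l / S%:R * (1 + s ^+ 2) <= 1 / 8 ->
    forall N : noise_model n.+1 s,
    (minimax_risk (bounded_holder_class h beta L) N <=
     (B * n.+1%:R^-1 `^ (Num.min 1 beta) +
      (2 * h)^-1 * (C * (S%:R / n.+1%:R) `^ beta +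
       diff_weight_norm M * (a + l^-1 * (n.+1%:R * M%:R * 2 *
         expR (- l * a + 2 * l ^+ 2 * (1 + s ^+ 2) ^+ 2 / S%:R)))))%:E)%E].
Proof.
move=> b0 L0 h0 M.
have [B B0 HB] := bounded_holder_modulus b0 L0 h0.
have [C C0 HC] := holder_square_difference b0 L0 h0.
exists B, C; split => // n S s a l S0 MS s0 a0 l0 lS N.
set Q := n.+1%:R * M%:R * 2 * _.
have HI : (minimax_risk (bounded_holder_class h beta L) N <=
    ereal_sup [set risk N (estimator_fun S M s h) f |
    f in bounded_holder_class h beta L])%E.
  apply: ereal_inf_lbound; exists (estimator_fun S M s h) => //.
  exact: estimator_fun_estimator.
apply: (le_trans HI); apply: ge_ereal_sup => _ [f fS <-].
have [_ fh] := fS.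
have f01 (i : 'I_n.+1) : 0 < f (i.+1%:R / n.+1%:R) <= 1.
  have /andP[hf ->] := fh _ (design01 i).
  by rewrite andbT (lt_le_trans h0).
have m0 : 0 <= Num.min 1 beta by rewrite le_min ler01 ltW.
have mQ : measurable_fun setT (fun w => exponential_sum S M s f a l (observation (N := N) f w)).
  apply: measurableT_comp; last exact: measurable_observation.
  apply: measurable_sum => i; apply: measurable_sum => j.
  have md := measurable_block_deviation S s f i j.+1.
  apply: measurable_funD; apply: measurableT_comp => //; apply: measurable_funM => //;
    apply: measurable_funB => //.
  under eq_fun do rewrite -mulN1r.
  exact: measurable_funM.
have Q0 w : 0 <= exponential_sum S M s f a l (observation (N := N) f w).
  by do 2 (apply: sumr_ge0 => ? _); rewrite addr_ge0 ?expR_ge0.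
set c1 : R := (2 * h)^-1 * diff_weight_norm M * l^-1.
set c0 : R := B * n.+1%:R^-1 `^ Num.min 1 beta + (2 * h)^-1 * (C * (S%:R / n.+1%:R) `^ beta + diff_weight_norm M * a).
have W0 : 0 <= diff_weight_norm M :> R by apply: sumr_ge0.
have h20 : 0 <= (2 * h)^-1 by rewrite invr_ge0 mulr_ge0// ltW.
have c10 : 0 <= c1.
  by apply: mulr_ge0; [exact: mulr_ge0|rewrite invr_ge0 ltW].
have c00 : 0 <= c0.
  rewrite /c0 addr_ge0// ?mulr_ge0 ?powR_ge0//.
  by rewrite addr_ge0 ?mulr_ge0 ?powR_ge0.
apply: (@le_trans _ _ (\int[noise_prob N]_w (c0%:E +
    c1%:E * (exponential_sum S M s f a l (observation (N := N) f w))%:E))%E).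
  apply: ge0_le_integral => //.
  - by move=> w _; exact: sup_norm01_ge0.
  - apply: (@measurableT_comp _ _ _ _ _ _ (fun y => sup_norm01 (fun x => (f x - estimator_fun S M s h y x)%R))).
      by have [_] := @estimator_fun_estimator R n S M s h (bounded_holder_class h beta L); apply.
    exact: measurable_observation.
  - apply: emeasurable_funD => //; apply: measurable_funeM.
    exact/measurable_EFinP.
  - move=> w _; have /= := estimator_loss s S0 (ltn0Sn _ : (0 < M)%N) MS h0
      (observation (N := N) f w) B0 C0 (ltW b0) a0 l0 m0 fh (HB f fS) (HC f fS).
    move=> H; apply: le_trans H _.
    rewrite -EFinM -EFinD lee_fin /c0 /c1 le_eqVlt; apply/orP; left; apply/eqP; ring.
have mQ' : measurable_fun setT (fun w =>
    (exponential_sum S M s f a l (observation (N := N) f w))%:E).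
  exact/measurable_EFinP.
rewrite ge0_integralD//; last 2 first.
- by move=> w _; rewrite mule_ge0// lee_fin.
- exact: measurable_funeM.
rewrite integral_cst//= probability_setT mule1 ge0_integralZl//.
rewrite [leRHS](_ : _ = c0%:E + c1%:E * Q%:E)%E; last first.
  by rewrite -EFinM -EFinD /c0 /c1; congr EFin; ring.
rewrite leeD2l// lee_wpmul2l// ?lee_fin//.
  exact: expectation_exponential_sum.
by move=> w _; rewrite lee_fin.
Qed.

End minimax_upper.

(** * Smooth bumps of prescribed width and height *)

Section bump.
Context {R : realType}.
Implicit Types (u x y : R) (q : {poly R}).

(** A quadratic bound on the remainder replaces the limit: the square of a
    positive part is differentiated without examining the sign on either side
    of a zero. *)
Lemma quadratic_is_derive (F : R -> R) (g x C : R) :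
  (forall y, `|y - x| <= 1 -> `|F y - F x - g * (y - x)| <= C * (y - x) ^+ 2) ->
  is_derive x 1 F g.
Proof.
move=> H.
have C0 : 0 <= C.
  have := H (x + 1); rewrite addrAC subrr add0r normr1 expr1n !mulr1 => /(_ (lexx _)).
  by move=> hC; apply: le_trans hC.
have key : t^-1 *: (F (t *: 1 + x) - F x) @[t --> 0^'] --> g.
  apply/cvgrPdist_le => e e0.
  pose r := Num.min 1 (e / (C + 1)).
  have C10 : 0 < C + 1 by lra.
  have r0 : 0 < r by rewrite lt_min ltr01 divr_gt0.
  apply/nbhs_ballP; exists r => //= t; rewrite /ball/= sub0r normrN lt_min.
  move=> /andP[t1 tr] t0.
  rewrite /GRing.scale/= mulr1.
  have := H (t + x); rewrite addrK => /(_ (ltW t1)) hh.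
  rewrite -(ler_pM2r (_ : 0 < `|t|)) ?normr_gt0//.
  rewrite -normrM mulrBl mulrAC mulVf// mul1r distrC.
  apply: le_trans hh _; rewrite -(real_normK (num_real t)) expr2 mulrA.
  rewrite ler_wpM2r//; move: tr; rewrite ltr_pdivlMr// => tr.
  have := normr_ge0 t; nra.
have dv : derivable F x 1 by apply/cvg_ex; exists g.
by apply: DeriveDef => //; apply/cvg_lim.
Qed.

Definition parabola : {poly R} := 'X * (1 - 'X).

Lemma parabolaE u : parabola.[u] = u * (1 - u).
Proof. by rewrite /parabola !hornerE. Qed.

Lemma parabola_deriv u : parabola^`().[u] = 1 - 2 * u.
Proof.
rewrite /parabola derivM derivB derivX -[1]/(1%:P) derivC !hornerE; ring.
Qed.

Definition pos_parabola u : R := Num.max 0 parabola.[u].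

(** This identity is what makes the derivatives below polynomial multiples of
    the same function. *)
Lemma pos_parabolaM u : pos_parabola u * parabola.[u] = pos_parabola u ^+ 2.
Proof. by rewrite /pos_parabola; case: lerP => _; rewrite ?mul0r ?expr0n// expr2. Qed.

Lemma pos_parabola_sqr_derive u :
  is_derive u 1 (fun u => pos_parabola u ^+ 2) (2 * pos_parabola u * parabola^`().[u]).
Proof.
have sq (a b : R) : `|Num.max 0 b ^+ 2 - Num.max 0 a ^+ 2 - 2 * Num.max 0 a * (b - a)|
    <= (b - a) ^+ 2.
  have sab := sqr_ge0 (b - a); have sa := sqr_ge0 a; have sb := sqr_ge0 b.
  case: (lerP 0 a) => a0; case: (lerP 0 b) => b0; rewrite ?expr0n/= ?mulr0 ?mul0r ?subr0.
  - by rewrite ler_norml; apply/andP; split; nra.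
  - have ab : a * b <= 0 by rewrite mulr_ge0_le0// ltW.
    by rewrite ler_norml; apply/andP; split; nra.
  - have ab : a * b <= 0 by rewrite mulr_le0_ge0// ltW.
    by rewrite ler_norml; apply/andP; split; nra.
  - by rewrite normr0.
pose D := `|1 - 2 * u| + 1.
apply: (@quadratic_is_derive _ _ _ (D ^+ 2 + 2 * pos_parabola u)) => y yu.
have := sq parabola.[u] parabola.[y]; rewrite -!/(pos_parabola _).
rewrite parabola_deriv.
have E : parabola.[y] - parabola.[u] = (1 - 2 * u) * (y - u) - (y - u) ^+ 2.
  by rewrite !parabolaE; ring.
rewrite E => H.
rewrite (_ : _ - _ - _ = (pos_parabola y ^+ 2 - pos_parabola u ^+ 2 -
   2 * pos_parabola u * ((1 - 2 * u) * (y - u) - (y - u) ^+ 2)) -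
   2 * pos_parabola u * (y - u) ^+ 2); last by ring.
have p0 : 0 <= pos_parabola u by rewrite le_max lexx.
apply: le_trans (ler_normB _ _) _; rewrite [leRHS]mulrDl; apply: lerD; last first.
  by rewrite ger0_norm// mulr_ge0 ?sqr_ge0// mulr_ge0.
apply: le_trans H _.
rewrite (_ : _ - _ = (1 - 2 * u - (y - u)) * (y - u)); last by ring.
rewrite exprMn ler_wpM2r ?sqr_ge0//.
rewrite -(real_normK (num_real (1 - 2 * u - _))) lerXn2r ?nnegrE ?addr_ge0//.
by apply: le_trans (ler_normB _ _) _; rewrite lerD2l.
Qed.

(** Polynomials cut off outside the unit interval: the square of the positive
    part is differentiable across the endpoints. *)
Definition bump_poly q u : R := pos_parabola u ^+ 2 * q.[u].

Definition bump_step q : {poly R} := 2 *: (parabola^`() * q) + (parabola * q)^`().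

Lemma bump_poly_derive q u :
  is_derive u 1 (bump_poly (parabola * q)) (bump_poly (bump_step q) u).
Proof.
have := pos_parabola_sqr_derive u => d1.
have d2 : is_derive u 1 (horner (parabola * q)) ((parabola * q)^`().[u]) by exact: is_derive_poly.
apply: (@is_derive_eq _ _ _ _ _ _ _ _ (is_deriveM d1 d2)).
rewrite /bump_poly /bump_step hornerD hornerZ (hornerM parabola q) (hornerM _^`() q) /GRing.scale/=.
have := pos_parabolaM u.
move: (pos_parabola u) parabola.[u] parabola^`().[u] (_^`().[u]) q.[u] => w V V' Q' Q wV.
rewrite (_ : V * Q * _ = 2 * V' * Q * (w * V)); last by ring.
by rewrite wV; ring.
Qed.

Lemma pos_parabola_out u : ~~ (0 < u < 1) -> pos_parabola u = 0.
Proof.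
move=> u01; apply/max_l; rewrite parabolaE.
have [u0|u0] := lerP u 0; first nra.
by move: u01; rewrite u0/= -leNgt => u1; nra.
Qed.

Lemma pos_parabola_itv u : 0 <= pos_parabola u <= 1.
Proof.
rewrite le_max lexx/= ge_max ler01/= parabolaE.
have [u0|u0] := lerP u 0; first nra.
by have [u1|u1] := lerP u 1; nra.
Qed.

Lemma bump_poly_bounded q : exists2 C, 0 <= C & forall u, `|bump_poly q u| <= C.
Proof.
have [C HC] := poly_itv_bound q 0 1.
have C0 : 0 <= C by apply: le_trans (HC 0 _); rewrite ?lexx ?ler01.
exists C => // u.
have [/andP[u0 u1]|u01] := boolP (0 < u < 1); last first.
  by rewrite /bump_poly pos_parabola_out// expr0n/= mul0r normr0.
rewrite /bump_poly normrM -[leRHS]mul1r ler_pM//; last first.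
  by apply: HC; rewrite !ltW.
have /andP[p0 p1] := pos_parabola_itv u.
by rewrite ger0_norm ?sqr_ge0// exprn_ile1.
Qed.

(** The [j]-th derivative of the [(p + 2)]-nd power of the positive parabola is
    a polynomial multiple of its [(p + 2 - j)]-th power; [bump_factor p j] is
    that multiple. *)
Fixpoint bump_factor (p j : nat) : {poly R} :=
  if j is j'.+1 then
    (p - j').+2%:R *: (parabola^`() * bump_factor p j') +
      parabola * (bump_factor p j')^`()
  else 1.

Definition bump_deriv (p j : nat) : R -> R :=
  bump_poly (parabola ^+ (p - j) * bump_factor p j).

Lemma bump_step_parabola e q : bump_step (parabola ^+ e * q) =
  parabola ^+ e * (e.+3%:R *: (parabola^`() * q) + parabola * q^`()).
Proof.
rewrite /bump_step; move: parabola => P.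
rewrite [P * (_ * q)]mulrA -exprS derivM deriv_exp/= !scaler_nat.
rewrite exprSr mulrDr mulrnAr mulrnAl mulrA addrA; congr (_ + _).
  by rewrite -mulrnDr; congr (_ *+ _); rewrite mulrA [P ^+ e * _]mulrC.
by rewrite mulrA.
Qed.

Lemma bump_deriv_derive p j u : (j < p)%N ->
  is_derive u 1 (bump_deriv p j) (bump_deriv p j.+1 u).
Proof.
move=> jp; rewrite /bump_deriv.
have pj : (p - j = (p - j.+1).+1)%N by rewrite subnSK.
rewrite {1}pj exprS -mulrA.
apply: (@is_derive_eq _ _ _ _ _ _ _ _ (bump_poly_derive _ _)).
congr bump_poly.
by rewrite bump_step_parabola /= pj.
Qed.

Lemma bump_deriv_bounded p j : exists2 C, 0 <= C & forall u, `|bump_deriv p j u| <= C.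
Proof. exact: bump_poly_bounded. Qed.

Definition bump_height (p : nat) : R := 4^-1 ^+ p.+2.

Lemma bump_deriv0E p u : bump_deriv p 0 u = pos_parabola u ^+ p.+2.
Proof.
rewrite /bump_deriv /bump_poly subn0 mulr1 horner_exp.
elim: p => [|p IH]; first by rewrite expr0 mulr1.
by rewrite [parabola.[u] ^+ _]exprSr mulrA IH [in LHS]exprSr -mulrA pos_parabolaM -exprD addn2.
Qed.

Lemma bump_deriv0_center p : bump_deriv p 0 2^-1 = bump_height p.
Proof.
rewrite bump_deriv0E /pos_parabola parabolaE /bump_height; congr (_ ^+ _).
by rewrite max_r; [field|lra].
Qed.

Lemma bump_deriv0_itv p u : 0 <= bump_deriv p 0 u <= 1.
Proof.
rewrite bump_deriv0E; have /andP[w0 w1] := pos_parabola_itv u.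
by rewrite exprn_ge0//= exprn_ile1.
Qed.

Lemma bump_deriv0_out p u : ~~ (0 < u < 1) -> bump_deriv p 0 u = 0.
Proof. by move=> u01; rewrite bump_deriv0E pos_parabola_out// expr0n. Qed.

Definition scaled_bump (p : nat) (A delta x0 : R) (j : nat) (x : R) : R :=
  A / delta ^+ j * bump_deriv p j ((x - x0) / delta).

Lemma scaled_bump_derive p (A delta x0 c : R) j : (j < p)%N -> 0 < delta ->
  increment01 (fun x => c + scaled_bump p A delta x0 j x)
    (fun x => 0 + scaled_bump p A delta x0 j.+1 x).
Proof.
move=> jp d0; apply: is_derive_increment01 => x.
pose g := fun x : R => (x - x0) / delta.
have dg : is_derive x 1 g (delta^-1).
  apply: (@quadratic_is_derive _ _ _ 0) => y _.
  by rewrite mul0r (_ : _ - _ = 0) ?normr0// /g; ring.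
have db := is_derive1_comp (bump_deriv_derive (g x) jp) dg.
have := is_deriveD (is_derive_cst c x 1) (is_deriveZ (A / delta ^+ j) db).
rewrite /GRing.scale/= => H; apply: is_derive_eq.
by rewrite /scaled_bump exprSr invfM -/(g x); ring.
Qed.

(** The [k]-th derivative of the bump is bounded and Lipschitz.  At distances
    below its width the Lipschitz bound is used, above it the uniform bound;
    either is at most the power [beta - k] of the distance relative to the
    width, and the height [delta ^ beta] compensates the scaling. *)
Lemma holder_bump (beta L : R) : 0 < beta -> 0 < L ->
  let p := (smoothness_order beta).+1 in
  exists2 K, 0 < K & forall kappa delta x0 c, 0 <= kappa <= K -> 0 < delta ->
    holder_class beta L (fun x => c + kappa * delta `^ beta * bump_deriv p 0 ((x - x0) / delta)).
Proof.
move=> b0 L0 p.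
have [kb bk] := andP (smoothness_orderP b0).
set k := smoothness_order beta in p kb bk *.
have a0 : 0 < beta - k%:R by rewrite subr_gt0.
have a1 : beta - k%:R <= 1 by rewrite lerBlDr addrC natr1.
have [C1 C10 HC1] := bump_deriv_bounded p k.
have [C2 C20 HC2] := bump_deriv_bounded p k.+1.
pose C := C2 + 2 * C1 + 1.
have C0 : 0 < C by rewrite /C; lra.
exists (L / C) => [|kappa delta x0 c /andP[kap0 kapL] d0]; first exact: divr_gt0.
pose A := kappa * delta `^ beta.
have A0 : 0 <= A by rewrite mulr_ge0 ?powR_ge0.
exists (fun j x => (if j is 0%N then c else 0) + scaled_bump p A delta x0 j x).
split.
- by apply/funext => x; rewrite /scaled_bump expr0 divr1.
- move=> j jk; apply/has_derivative01P.
  by apply: scaled_bump_derive => //; rewrite /p ltnS ltnW.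
- move=> x y x01 y01; rewrite -/k.
  have -> (u v w : R) : `|(w + u) - (w + v)| = `|u - v| by congr `|_|; ring.
  pose z := `|x - y| / delta; pose a := beta - k%:R.
  have z0 : 0 <= z by rewrite divr_ge0// ltW.
  have dk0 : 0 < delta ^+ k by rewrite exprn_gt0.
  have Adk0 : 0 <= A / delta ^+ k by rewrite divr_ge0// ltW.
  have H : `|scaled_bump p A delta x0 k x - scaled_bump p A delta x0 k y| <=
      A / delta ^+ k * (C * z `^ a).
    have [z1|z1] := lerP z 1.
      have kp : (k < p)%N by [].
      have [t [t01 _]] := increment01_MVTsym (scaled_bump_derive A x0 0 kp d0) y01 x01.
      rewrite !add0r => ->; rewrite normrM /scaled_bump normrM.
      have -> : `|A / delta ^+ k.+1| = A / delta ^+ k / delta.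
        by rewrite exprSr invfM mulrA ger0_norm// divr_ge0// ltW.
      rewrite (_ : _ * `|x - y| = A / delta ^+ k * (`|bump_deriv p k.+1 ((t - x0) / delta)| * z)); last first.
        by rewrite /z; ring.
      rewrite ler_wpM2l//; apply: ler_pM => //.
        by apply: le_trans (HC2 _) _; rewrite /C; lra.
      have [->|zn0] := eqVneq z 0; first exact: powR_ge0.
      by apply: ger1_powR => //; rewrite z1 lt0r zn0 z0.
    rewrite /scaled_bump -mulrBr normrM ger0_norm// ler_wpM2l//.
    apply: (@le_trans _ _ (C * 1)).
      rewrite mulr1; apply: le_trans (ler_normB _ _) _.
      by have := HC1 ((x - x0) / delta); have := HC1 ((y - x0) / delta); rewrite /C; lra.
    rewrite ler_wpM2l ?(ltW C0)// (_ : 1 = 1 `^ a); last by rewrite powR1.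
    by rewrite ge0_ler_powR ?nnegrE// ltW.
  apply: le_trans H _.
  have daz : delta `^ a * z `^ a = `|x - y| `^ a.
    by rewrite -powRM ?(ltW d0)// /z mulrC divfK// gt_eqF.
  have db : delta `^ beta = delta ^+ k * delta `^ a.
    by rewrite -powR_mulrn ?(ltW d0)// -powRD ?(gt_eqF d0) ?implybT// /a addrC subrK.
  rewrite -daz /A db (_ : _ * _ = kappa * C * (delta `^ a * z `^ a)); last first.
    by field; exact: lt0r_neq0.
  rewrite ler_wpM2r ?mulr_ge0 ?powR_ge0//.
  by rewrite -ler_pdivlMr.
Qed.

End bump.

(** * Lower bound by testing against a mixture *)

Section lower.
Context {R : realType} (n : nat) (s : R) (N : noise_model n s).
Hypothesis s0 : 0 <= s.
Local Notation P := (noise_prob N).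

Variables (m : nat) (f0 : R -> R) (fs : 'I_m -> R -> R).
Hypothesis m0 : (0 < m)%N.
Hypothesis f00 : forall i : 'I_n, 0 < f0 (i.+1%:R / n%:R).
Hypothesis fs0 : forall j (i : 'I_n), 0 < fs j (i.+1%:R / n%:R).
Let u j (i : 'I_n) : R := obs_var s (fs j) i / obs_var s f0 i - 1.
Hypothesis u01 : forall j i, 0 <= u j i <= 1 / 2.
Hypothesis usum : forall j, expR (\sum_i u j i ^+ 2) <= m%:R.
Hypothesis disjoint : forall j k (i : 'I_n), j != k ->
  fs j (i.+1%:R / n%:R) = f0 (i.+1%:R / n%:R) \/
  fs k (i.+1%:R / n%:R) = f0 (i.+1%:R / n%:R).

Let v0 (i : 'I_n) : 0 < obs_var s f0 i.
Proof. by rewrite /obs_var ltr_pwDl ?exprn_gt0 ?sqr_ge0. Qed.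

Let lr j (i : 'I_n) := likelihood_ratio (obs_var s f0 i) (obs_var s (fs j) i).

Let mlr j i : measurable_fun setT (lr j i).
Proof. exact: measurable_likelihood_ratio. Qed.

Let lr0 j i y : 0 <= lr j i y. Proof. exact: likelihood_ratio_ge0. Qed.

Let integral_lr j i :
  (\int[normal_prob 0 (Num.sqrt (obs_var s f0 i))]_y (lr j i y)%:E = 1)%E.
Proof.
have := @integral_likelihood_ratio R _ (obs_var s (fs j) i) setT (v0 i) measurableT.
rewrite probability_setT => <-; apply: eq_integral => y _.
by rewrite indicT mule1.
Qed.

Let lr_const j (i : 'I_n) y : fs j (i.+1%:R / n%:R) = f0 (i.+1%:R / n%:R) -> lr j i y = 1.
Proof.
move=> E; rewrite /lr /likelihood_ratio /obs_var E divff//.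
by rewrite lt0r_neq0// normal_pdf_gt0// sqrtr_gt0 v0.
Qed.

(** At any point at most one of two distinct alternatives differs from [f0], so
    that one of the two likelihood ratios is identically one. *)
Let cross j k i :
  (\int[normal_prob 0 (Num.sqrt (obs_var s f0 i))]_y (lr j i y * lr k i y)%:E <=
  (if j == k then expR (u j i ^+ 2) else 1)%:E)%E.
Proof.
case: eqP => [<-|/eqP jk].
  have := @integral_likelihood_ratio_sqr R _ _ (v0 i) (u01 j i).
  rewrite (_ : obs_var s f0 i * _ = obs_var s (fs j) i); last first.
    by rewrite /u addrC subrK mulrC divfK// lt0r_neq0.
  by under eq_integral do rewrite expr2.
have [E|E] := disjoint i jk.
  by under eq_integral do rewrite (lr_const _ E) mul1r; rewrite integral_lr.
by under eq_integral do rewrite (lr_const _ E) mulr1; rewrite integral_lr.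
Qed.

Let Y0 w i := tnth (observation (N := N) f0 w) i.
Let Lik j w := \prod_i lr j i (Y0 w i).

Let Lik0 j w : 0 <= Lik j w. Proof. exact: prodr_ge0. Qed.

Let mLik j : measurable_fun setT (Lik j).
Proof.
have : measurable_fun setT (fun w => (Lik j w)%:E).
  rewrite /Lik; under eq_fun do rewrite -prodEFin.
  apply: measurable_prode => i; apply/measurable_EFinP.
  by apply: measurableT_comp => //; exact: measurable_observation_tnth.
by move/measurable_EFinP.
Qed.

Let cross_moment j k :
  (\int[P]_w (Lik j w * Lik k w)%:E <= (if j == k then m%:R else 1)%:E)%E.
Proof.
rewrite [leLHS](_ : _ = \int[P]_w (\prod_i (lr j i (Y0 w i) * lr k i (Y0 w i)))%:E)%E; last first.
  by apply: eq_integral => w _; rewrite big_split.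
rewrite (@integral_prod_observation _ _ _ N s0 f0 (fun i y => lr j i y * lr k i y))//.
- apply: (@le_trans _ _ (\prod_i (if j == k then expR (u j i ^+ 2) else 1)%:E)%E).
    apply: lee_prod => i; rewrite cross andbT.
    by apply: integral_ge0 => y _; rewrite lee_fin mulr_ge0.
  rewrite prodEFin lee_fin; case: eqP => _; last by rewrite big1.
  by rewrite -expR_sum.
- by move=> i; exact: measurable_funM.
- by move=> i y; rewrite mulr_ge0.
- move=> i; rewrite ge0_fin_numE; first exact: le_lt_trans (cross j k i) (ltry _).
  by apply: integral_ge0 => y _; rewrite lee_fin mulr_ge0.
Qed.

Let Lbar w := m%:R^-1 * \sum_j Lik j w.

Let mLbar : measurable_fun setT Lbar.
Proof. by apply: measurable_funM => //; exact: measurable_sum. Qed.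

Let Lbar0 w : 0 <= Lbar w.
Proof. by rewrite mulr_ge0 ?invr_ge0// sumr_ge0. Qed.

(** Distinct alternatives have uncorrelated likelihood ratios, so that averaging
    over [m] of them divides the excess of the second moment by [m]: squares as
    large as [m] are harmless. *)
Let second_moment : (\int[P]_w (Lbar w ^+ 2)%:E <= 2%:E)%E.
Proof.
have m00 : 0 < m%:R :> R by rewrite ltr0n.
have mterm j k : measurable_fun setT (fun w => (Lik j w * Lik k w)%:E).
  by apply/measurable_EFinP; exact: measurable_funM.
have term0 j k w : (0 <= (Lik j w * Lik k w)%:E)%E by rewrite lee_fin mulr_ge0.
rewrite [leLHS](_ : _ = \int[P]_w ((m%:R^-1 ^+ 2)%:E *
   \sum_(j < m) \sum_(k < m) (Lik j w * Lik k w)%:E))%E; last first.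
  apply: eq_integral => w _; rewrite /Lbar exprMn EFinM; congr (_ * _)%E.
  rewrite [X in X%:E]expr2 mulr_suml -sumEFin; apply: eq_bigr => j _.
  by rewrite mulr_sumr -sumEFin.
rewrite ge0_integralZl//; first last.
- by move=> w _; apply: sume_ge0 => j _; apply: sume_ge0.
- by apply: emeasurable_sum => j; apply: emeasurable_sum.
rewrite ge0_integral_sum//; first last.
- by move=> j w _; apply: sume_ge0.
- by move=> j; apply: emeasurable_sum.
apply: (@le_trans _ _ ((m%:R^-1 ^+ 2)%:E * (2 * m%:R ^+ 2)%:E)%E); last first.
  by rewrite -EFinM lee_fin exprVn mulrCA mulVf ?mulr1// expf_neq0// gt_eqF.
rewrite lee_wpmul2l ?lee_fin ?sqr_ge0//.
apply: (@le_trans _ _ (\sum_(j < m) (2 * m%:R)%:E)%E); last first.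
  by rewrite sumEFin sumr_const card_ord -(mulr_natl (2 * m%:R)) mulrCA -expr2.
apply: lee_sum => j _; rewrite ge0_integral_sum//.
apply: (@le_trans _ _ (\sum_(k < m) (if j == k then m%:R else 1)%:E)%E).
  by apply: lee_sum => k _; exact: cross_moment.
rewrite sumEFin lee_fin (bigD1 j)//= eqxx.
apply: (@le_trans _ _ (m%:R + \sum_(k < m) 1)); last first.
  by rewrite sumr_const card_ord mulr_natl mulr2n.
rewrite lerD2l [leRHS](bigD1 j)//= ler_wpDl//.
by apply: ler_sum => k kj; rewrite eq_sym (negbTE kj).
Qed.

(** On the event, the average likelihood ratio [L] is bounded by
    [L^2 / 8 + 2]: the second moment controls the first term, and the
    probability under [f0] the second. *)
Let average_le (E : set (n.-tuple R)) : measurable E ->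
  (P (observation (N := N) f0 @^-1` E) <= (1 / 8)%:E)%E ->
  (\sum_(j < m) P (observation (N := N) (fs j) @^-1` E) <= (m%:R / 2)%:E)%E.
Proof.
move=> mE PE.
have m00 : 0 < m%:R :> R by rewrite ltr0n.
pose Y := observation (N := N) f0.
have mYE : measurable (Y @^-1` E).
  by rewrite -[X in measurable X]setTI; exact: measurable_observation.
have mL j : measurable_fun (Y @^-1` E) (fun w => (Lik j w)%:E).
  by apply/measurable_EFinP; exact: measurable_funTS.
rewrite (eq_bigr (fun j => \int[P]_(w in Y @^-1` E) (Lik j w)%:E)%E); last first.
  by move=> j _; exact: change_of_measure.
rewrite -ge0_integral_sum//; last by move=> j w _; rewrite lee_fin.
apply: (@le_trans _ _ (\int[P]_(w in Y @^-1` E)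
   (m%:R%:E * ((8^-1)%:E * (Lbar w ^+ 2)%:E + 2%:E))))%E.
  apply: ge0_le_integral => //.
  - by move=> w _; apply: sume_ge0 => j _; rewrite lee_fin.
  - exact: emeasurable_sum.
  - apply: measurable_funeM; apply: emeasurable_funD => //; apply: measurable_funeM.
    by apply: measurable_funTS; apply/measurable_EFinP; exact: measurable_funX.
  - move=> w _; rewrite sumEFin -[leRHS]/((m%:R * (8^-1 * Lbar w ^+ 2 + 2))%:E) lee_fin.
    rewrite -ler_pdivrMl//; rewrite -/(Lbar w).
    by have := sqr_ge0 (Lbar w - 4); nra.
have mS : measurable_fun setT (fun w => (Lbar w ^+ 2)%:E).
  by apply/measurable_EFinP; exact: measurable_funX.
have S0 w : (0 <= (Lbar w ^+ 2)%:E)%E by rewrite lee_fin sqr_ge0.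
have mS' : measurable_fun (Y @^-1` E) (fun w => (Lbar w ^+ 2)%:E).
  exact: measurable_funTS.
rewrite ge0_integralZl//; last 2 first.
- apply: emeasurable_funD => //; exact: measurable_funeM.
- by move=> w _; rewrite adde_ge0// mule_ge0// lee_fin.
rewrite ge0_integralD//; last 2 first.
- by move=> w _; rewrite mule_ge0// lee_fin.
- exact: measurable_funeM.
rewrite ge0_integralZl// ?lee_fin// integral_cst//=.
apply: (@le_trans _ _ (m%:R%:E * ((8^-1)%:E * 2%:E + 2%:E * (1 / 8)%:E)))%E.
  rewrite lee_wpmul2l ?lee_fin// leeD//.
    rewrite lee_wpmul2l ?lee_fin//; apply: le_trans second_moment.
    exact: ge0_subset_integral.
  by rewrite lee_wpmul2l// lee_fin.
by rewrite -[leLHS]/((m%:R * (8^-1 * 2 + 2 * (1 / 8)))%:E) lee_fin ler_wpM2l//; lra.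
Qed.

(** If all risks were below [rho / 8], the event that the estimator is far from
    [f0] would have probability at most 1/8 under [f0] by Markov's inequality,
    and at least 7/8 under every alternative, where the estimator is close to a
    function [2 rho] away from [f0]. *)
Lemma mixture_lower_bound (Sigma : set (R -> R)) (rho : R) :
  0 < rho -> Sigma f0 -> (forall j, Sigma (fs j)) ->
  (forall j, exists2 x, x \in `[0, 1] & 2 * rho <= `|f0 x - fs j x|) ->
  ((rho / 8)%:E <= minimax_risk Sigma N)%E.
Proof.
move=> rho0 Sf0 Sfs sep; apply: le_ereal_inf_tmp => _ [nu [_ mloss] <-].
rewrite leNgt; apply/negP => risk_lt.
have riskS f : Sigma f -> (risk N nu f < (rho / 8)%:E)%E.
  move=> Sf; apply: le_lt_trans risk_lt; apply: ereal_sup_ubound.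
  by exists f.
pose bad f : set (n.-tuple R) :=
  [set y | (rho%:E <= sup_norm01 (fun x => (f x - nu y x)%R))%E].
have mbad f : Sigma f -> measurable (bad f).
  move=> Sf; have := mloss f Sf => ml.
  by rewrite -[X in measurable X]setTI; exact: emeasurable_fun_c_infty.
have Pbad f : Sigma f -> (P (observation (N := N) f @^-1` bad f) <= (1 / 8)%:E)%E.
  move=> Sf; have ml := mloss f Sf.
  have mobs := measurable_observation (N := N) f.
  have mEv : measurable (observation (N := N) f @^-1` bad f).
    by rewrite -[X in measurable X]setTI; apply: mobs => //; exact: mbad.
  have : (rho%:E * P (observation (N := N) f @^-1` bad f) <= risk N nu f)%E.
    rewrite -integral_cst//=.
    apply: (@le_trans _ _ (\int[P]_(w in observation (N := N) f @^-1` bad f)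
       sup_norm01 (fun x => (f x - nu (observation f w) x)%R)))%E.
      apply: ge0_le_integral => //.
      - by move=> w _; rewrite lee_fin ltW.
      - apply: measurable_funTS.
        by apply: (measurableT_comp ml); exact: mobs.
    apply: ge0_subset_integral => //.
      by apply: (measurableT_comp ml); exact: mobs.
    by move=> w _; exact: sup_norm01_ge0.
  move=> /le_lt_trans/(_ (riskS f Sf)) /ltW.
  by rewrite -lee_pdivlMl// -EFinM mulKf ?gt_eqF// div1r.
have far j : ((7 / 8)%:E <= P (observation (N := N) (fs j) @^-1` bad f0))%E.
  have mobs := measurable_observation (N := N) (fs j).
  have mE f : Sigma f -> measurable (observation (N := N) (fs j) @^-1` bad f).
    by move=> Sf; rewrite -[X in measurable X]setTI; apply: mobs => //; exact: mbad.
  have cover : [set: noise_space N] = observation (N := N) (fs j) @^-1` bad f0 `|`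
      observation (N := N) (fs j) @^-1` bad (fs j).
    apply/esym/seteqP; split => // w _; set y := observation (fs j) w.
    have [|b0] := pselect (bad f0 y); [by left|].
    have [|bj] := pselect (bad (fs j) y); [by right|].
    move: b0 bj; rewrite /bad/= => /negP; rewrite -ltNge => b0 /negP; rewrite -ltNge => bj.
    have [x x01] := sep j; rewrite leNgt => /negP[].
    have lt_of f : (sup_norm01 (fun x => (f x - nu y x)%R) < rho%:E)%E -> `|f x - nu y x| < rho.
      move=> H; rewrite -lte_fin; apply: le_lt_trans H.
      by apply: ereal_sup_ubound; exists x.
    have := ltrD (lt_of _ b0) (lt_of _ bj).
    rewrite (_ : rho + rho = 2 * rho); last by ring.
    apply: le_lt_trans.
    rewrite (_ : f0 x - fs j x = (f0 x - nu y x) - (fs j x - nu y x)); last by ring.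
    exact: ler_normB.
  have : (1 <= P (observation (N := N) (fs j) @^-1` bad f0) + (1 / 8)%:E)%E.
    rewrite -(@probability_setT _ _ _ P) cover.
    apply: le_trans (measureU2 _ _ _) _; [exact: mE|exact: mE|].
    by rewrite leeD2l//; exact: Pbad.
  have fin : P (observation (N := N) (fs j) @^-1` bad f0) \is a fin_num.
    by apply: fin_num_measure; exact: mE.
  by rewrite -(fineK fin) -EFinD !lee_fin; lra.
have := average_le (mbad _ Sf0) (Pbad _ Sf0); apply/negP; rewrite -ltNge.
apply: (@lt_le_trans _ _ (\sum_(j < m) (7 / 8)%:E)%E); last by apply: lee_sum => j _; exact: far.
rewrite sumEFin sumr_const card_ord -(mulr_natl (7 / 8)) lte_fin ltr_pM2l ?ltr0n//; lra.
Qed.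

End lower.

(** * Lower bound for the minimax risk *)

Section minimax_lower.
Context {R : realType}.

Lemma count_ord_interval (n a q : nat) :
  (\sum_(i < n) (a <= i < a + q)%N <= q)%N.
Proof.
suff -> : (\sum_(i < n) (a <= i < a + q) = minn n (a + q) - a)%N by lia.
elim: n => [|n IH]; first by rewrite big_ord0 min0n sub0n.
by rewrite big_ord_recr/= IH; case: (boolP (a <= n < a + q)%N); lia.
Qed.

Lemma count_design_interval (n : nat) (a w : R) : 0 <= a -> 0 <= w ->
  \sum_(i < n) (a < i.+1%:R < a + w)%R%:R <= w + 1 :> R.
Proof.
move=> a0 w0.
have /andP[a1 a2] := truncn_itv a0; have /andP[w1 w2] := truncn_itv w0.
set ta := Num.truncn a in a1 a2; set tw := Num.truncn w in w1 w2.
apply: (@le_trans _ _ (\sum_(i < n) (ta <= i < ta + tw.+1)%N%:R)).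
  apply: ler_sum => i _; case: (boolP (a < i.+1%:R < a + w)) => [/andP[ai iaw]|_]; last exact: ler0n.
  rewrite (_ : (ta <= i < ta + tw.+1)%N = true)//; apply/andP; split.
    by rewrite -ltnS -(ltr_nat R); exact: le_lt_trans ai.
  rewrite -ltnS -(ltr_nat R) -addnS natrD; apply: lt_le_trans iaw _.
  by move: a2 w2; rewrite -!natr1; lra.
rewrite -natr_sum; apply: (@le_trans _ _ tw.+1%:R).
  by rewrite ler_nat; exact: count_ord_interval.
by rewrite -natr1 lerD2r.
Qed.

(** The alternatives add one of [1 / delta] disjoint bumps of width [delta] and
    height [kappa * delta ^ beta] to the constant [h].  About [n delta] design
    points lie below a bump, each contributing the square of the relative change
    of the variance to the exponent of the second moment. *)
Lemma minimax_risk_lower (beta L h : R) : 0 < beta -> 0 < L -> 0 < h < 1 ->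
  let p := (smoothness_order beta).+1 in
  exists2 K, 0 < K & forall (n : nat) (s kappa delta : R) (N : noise_model n s),
    (0 < n)%N -> 0 <= s -> 0 < kappa -> kappa <= K -> kappa <= 1 - h ->
    kappa <= h ^+ 2 / 4 -> 0 < delta <= 1 -> 1 <= n%:R * delta ->
    expR (8 * kappa ^+ 2 / h ^+ 4 *
      (n%:R * delta * (delta `^ beta) ^+ 2 / Num.max 1 (s ^+ 4))) <=
      (Num.truncn delta^-1)%:R ->
    ((kappa * bump_height p / 16 * delta `^ beta)%:E <=
      minimax_risk (bounded_holder_class h beta L) N)%E.
Proof.
move=> b0 L0 /andP[h0 h1] p.
have [K K0 HK] := holder_bump b0 L0; rewrite -/p in HK.
exists K => // n s kappa delta N n0 s0 k0 kK k1h kh2 /andP[d0 d1] nd expm.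
set m := Num.truncn delta^-1 in expm.
have di0 : 0 <= delta^-1 by rewrite invr_ge0 ltW.
have m0 : (0 < m)%N by rewrite truncn_gt0 -[leLHS]invr1 lef_pV2 ?posrE.
have md : m%:R * delta <= 1.
  by rewrite -ler_pdivlMr// div1r; have /andP[] := truncn_itv di0.
have nn0 : 0 < n%:R :> R by rewrite ltr0n.
pose A := kappa * delta `^ beta.
have db0 : 0 < delta `^ beta by rewrite powR_gt0.
have db1 : delta `^ beta <= 1 by rewrite powR_le1 ?(ltW b0)// (ltW d0).
have A0 : 0 < A by rewrite mulr_gt0.
have Ak : A <= kappa by rewrite /A ler_piMr// ltW.
pose pos (j : 'I_m) (x : R) := (x - j%:R * delta) / delta.
pose bmp (j : 'I_m) (x : R) := bump_deriv p 0 (pos j x).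
pose f0 := fun _ : R => h.
pose fs (j : 'I_m) := fun x : R => h + A * bmp j x.
have b01 j x : 0 <= bmp j x <= 1 by exact: bump_deriv0_itv.
have Sfs j : bounded_holder_class h beta L (fs j).
  split; first by apply: HK => //; rewrite (ltW k0).
  move=> x _; have /andP[bx0 bx1] := b01 j x; rewrite /fs lerDl mulr_ge0 ?(ltW A0)//=.
  by have : A * bmp j x <= A * 1 by [rewrite ler_wpM2l// ltW]; lra.
have Sf0 : bounded_holder_class h beta L f0.
  split; last by move=> x _; rewrite /f0 lexx ltW.
  have := HK 0 delta 0 h; rewrite lexx (ltW K0) => /(_ isT d0).
  by rewrite (_ : (fun x => _) = f0)//; apply/funext => x; rewrite !mul0r addr0.
have bmp_out j x : ~~ (0 < pos j x < 1) -> bmp j x = 0 by exact: bump_deriv0_out.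
pose mx := Num.max 1 (s ^+ 4).
have mx0 : 0 < mx by rewrite lt_max ltr01.
have v0 : 0 < h ^+ 2 + s ^+ 2 by rewrite ltr_pwDl ?exprn_gt0 ?sqr_ge0.
have v0mx : h ^+ 4 * mx <= (h ^+ 2 + s ^+ 2) ^+ 2.
  have h2 : 0 < h ^+ 2 by rewrite exprn_gt0.
  have s2 := sqr_ge0 s.
  have h21 : h ^+ 2 <= 1 by rewrite exprn_ile1// ltW.
  rewrite /mx (_ : h ^+ 4 = (h ^+ 2) ^+ 2); last by rewrite -exprM.
  rewrite (_ : s ^+ 4 = (s ^+ 2) ^+ 2); last by rewrite -exprM.
  move: (h ^+ 2) (s ^+ 2) h2 s2 h21 => a b a0 bb0 a1.
  have ab : a * b <= b by rewrite ler_piMl.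
  case: (lerP 1 (b ^+ 2)) => _; rewrite ?mulr1 -?exprMn lerXn2r ?nnegrE//.
  - by rewrite mulr_ge0// ltW.
  - by rewrite addr_ge0// ltW.
  - by lra.
  - by rewrite ltW.
  - by rewrite addr_ge0// ltW.
  - by lra.
pose u j (i : 'I_n) : R := obs_var s (fs j) i / obs_var s f0 i - 1.
have uE j i : u j i = (2 * h * (A * bmp j (i.+1%:R / n%:R)) + (A * bmp j (i.+1%:R / n%:R)) ^+ 2) / (h ^+ 2 + s ^+ 2).
  by rewrite /u /obs_var /fs /f0; field; exact: lt0r_neq0.
have ule j i : 0 <= u j i <= (2 * A / (h ^+ 2 + s ^+ 2)) * bmp j (i.+1%:R / n%:R).
  have /andP[bx0 bx1] := b01 j (i.+1%:R / n%:R); rewrite uE.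
  move: (bmp _ _) bx0 bx1 => b bb0 bb1.
  have Ab0 : 0 <= A * b by rewrite mulr_ge0// ltW.
  apply/andP; split.
    rewrite divr_ge0 ?(ltW v0)// addr_ge0 ?sqr_ge0//.
    by rewrite mulr_ge0// mulr_ge0// ltW.
  rewrite [leRHS]mulrAC ler_wpM2r ?invr_ge0 ?(ltW v0)//.
  have Ab : A * b <= A by rewrite ler_piMr ?(ltW A0).
  have hA : 2 * h + A * b <= 2 by lra.
  rewrite -[leRHS]mulrA (_ : _ + _ = (2 * h + A * b) * (A * b)); last by ring.
  exact: ler_wpM2r.
have Av : 2 * A / (h ^+ 2 + s ^+ 2) <= 1 / 2.
  rewrite ler_pdivrMr//; have := sqr_ge0 s; lra.
pose T := 4 * A ^+ 2 / (h ^+ 4 * mx).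
have T0 : 0 <= T.
  apply: divr_ge0; first by rewrite mulr_ge0// sqr_ge0.
  by apply: mulr_ge0; [rewrite exprn_ge0// ltW|exact: ltW].
have usq j i : u j i ^+ 2 <= T * (n%:R * (j%:R * delta) < i.+1%:R < n%:R * (j%:R * delta) + n%:R * delta)%R%:R.
  have /andP[u0 ub] := ule j i.
  case: (boolP (0 < pos j (i.+1%:R / n%:R) < 1)) => [|out]; last first.
    move: ub u0; rewrite bmp_out// mulr0 => ub u0.
    have -> : u j i = 0 by apply/eqP; rewrite eq_le ub u0.
    by rewrite expr0n/= mulr_ge0.
  rewrite /pos => /andP[p0 p1].
  have -> : n%:R * (j%:R * delta) < i.+1%:R < n%:R * (j%:R * delta) + n%:R * delta.
    have xn : i.+1%:R = n%:R * (i.+1%:R / n%:R) :> R by rewrite mulrC divfK// gt_eqF.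
    rewrite xn; move: p0 p1; rewrite pmulr_lgt0 ?invr_gt0// subr_gt0 => p0.
    rewrite ltr_pdivrMr// mul1r ltrBlDr addrC => p1.
    by rewrite -mulrDr !ltr_pM2l// p0.
  rewrite mulr1; apply: (@le_trans _ _ ((2 * A / (h ^+ 2 + s ^+ 2)) ^+ 2)).
    rewrite lerXn2r ?nnegrE//.
      by rewrite divr_ge0 ?(ltW v0)// mulr_ge0// ltW.
    apply: le_trans ub _; rewrite ler_piMr//; last by have /andP[] := b01 j (i.+1%:R / n%:R).
    by rewrite divr_ge0 ?(ltW v0)// mulr_ge0// ltW.
  rewrite expr_div_n /T (_ : (2 * A) ^+ 2 = 4 * A ^+ 2); last by ring.
  apply: ler_wpM2l; first by rewrite mulr_ge0// sqr_ge0.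
  by rewrite lef_pV2// posrE ?exprn_gt0// mulr_gt0// exprn_gt0.
have usum j : expR (\sum_i u j i ^+ 2) <= m%:R.
  apply: le_trans expm; rewrite ler_expR.
  apply: (@le_trans _ _ (T * (n%:R * delta + 1))).
    apply: (@le_trans _ _ (\sum_(i < n) T * (n%:R * (j%:R * delta) < i.+1%:R < n%:R * (j%:R * delta) + n%:R * delta)%R%:R)).
      by apply: ler_sum => i _; exact: usq.
    rewrite -mulr_sumr ler_wpM2l// count_design_interval// ?mulr_ge0 ?(ltW d0)//.
  apply: (@le_trans _ _ (T * (2 * (n%:R * delta)))).
    by rewrite ler_wpM2l//; lra.
  rewrite le_eqVlt; apply/orP; left; apply/eqP.
  by rewrite /T /A -/mx; field; rewrite !lt0r_neq0.
pose rho := A * bump_height p / 2.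
have bh0 : 0 < bump_height p :> R by rewrite exprn_gt0 ?invr_gt0.
have rho0 : 0 < rho by rewrite divr_gt0// mulr_gt0.
rewrite (_ : kappa * _ / 16 * _ = rho / 8); last by rewrite /rho /A; field.
apply: (@mixture_lower_bound R n s N s0 m f0 fs m0) => //.
- move=> j i; rewrite /fs ltr_wpDr// mulr_ge0 ?(ltW A0)//.
  by have /andP[] := b01 j (i.+1%:R / n%:R).
- move=> j i; rewrite -/(u j i); have /andP[-> ub] := ule j i.
  have /andP[bx0 bx1] := b01 j (i.+1%:R / n%:R).
  apply: le_trans ub _; rewrite -[leRHS]mulr1 ler_pM//.
  by rewrite divr_ge0 ?(ltW v0)// mulr_ge0// ltW.
- move=> j k i jk; set x := _ / _.
  have [/andP[j0 j1]|outj] := boolP (0 < pos j x < 1); last first.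
    by left; rewrite /fs bmp_out// mulr0 addr0.
  right; rewrite /fs bmp_out ?mulr0 ?addr0//; apply/negP => /andP[k0' k1'].
  have posE l : pos l x = x / delta - l%:R.
    by rewrite /pos mulrBl mulfK// gt_eqF.
  move: j0 j1 k0' k1'; rewrite !posE => j0 j1 k0' k1'.
  have jk1 : j%:R < k.+1%:R :> R by rewrite -natr1; lra.
  have kj1 : k%:R < j.+1%:R :> R by rewrite -natr1; lra.
  move: jk1 kj1; rewrite !ltr_nat !ltnS => jk1 kj1.
  by move/eqP: jk; apply; apply/val_inj/eqP; rewrite eqn_leq jk1.
- move=> j; exists ((j%:R + 2^-1) * delta).
    have jm : j%:R + 2^-1 <= m%:R :> R.
      have : j.+1%:R <= m%:R :> R by rewrite ler_nat.
      by rewrite -natr1; lra.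
    rewrite in_itv/= mulr_ge0 ?addr_ge0 ?(ltW d0)//=.
    by apply: le_trans md; rewrite ler_wpM2r ?(ltW d0).
  rewrite /f0 /fs opprD addrA subrr add0r normrN /bmp.
  rewrite (_ : pos j _ = 2^-1); last by rewrite /pos; field; exact: lt0r_neq0.
  rewrite bump_deriv0_center ger0_norm; last by apply: mulr_ge0; exact: ltW.
  by rewrite /rho mulrC divfK.
Qed.

End minimax_lower.

(** * Choice of the bandwidth and asymptotics *)

Section rates.
Context {R : realType}.

(** Blocks of [S ~ n delta] points balance bias and noise, both of order
    [delta ^ beta]. *)
Lemma minimax_risk_upper_rate (beta L h : R) : 0 < beta -> 0 < L -> 0 < h ->
  exists C eps : R, [/\ 0 < C, 0 < eps & forall (n : nat) (s delta : R) (N : noise_model n s),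
    (1 < n)%N -> 0 <= s -> 1 <= ln n%:R :> R -> 0 < delta <= eps ->
    n%:R * delta * (delta `^ beta) ^+ 2 = Num.max 1 (s ^+ 4) * ln n%:R ->
    n%:R^-1 <= delta -> n%:R^-1 <= delta `^ beta ->
    (minimax_risk (bounded_holder_class h beta L) N <= (C * delta `^ beta)%:E)%E].
Proof.
move=> b0 L0 h0.
set M := (smoothness_order beta).*2.+1.
have [B [C [B0 C0 Hup]]] := minimax_risk_upper b0 L0 h0; rewrite -/M in Hup.
have M0 : 0 < M%:R :> R by rewrite ltr0n.
pose W : R := diff_weight_norm M.
have W0 : 0 <= W by apply: sumr_ge0.
have ih0 : 0 < (2 * h)^-1 by rewrite invr_gt0 mulr_gt0.
pose Cst := B + (2 * h)^-1 * (C + W * (16 + 32 * M%:R)).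
have Cst0 : 0 <= Cst.
  apply: addr_ge0 => //; apply: mulr_ge0; first exact: ltW.
  apply: addr_ge0 => //; apply: mulr_ge0 => //; apply: addr_ge0 => //.
pose eps : R := Num.min (4 * M%:R)^-1 ((32^-1) `^ beta^-1).
have eps0 : 0 < eps by rewrite lt_min invr_gt0 mulr_gt0//= powR_gt0// invr_gt0.
exists (Cst + 1), eps; split => //; first by lra.
move=> [//|n] s delta N n1 s0 ln1 /andP[d0]; rewrite le_min => /andP[dM d32] nd invd invD.
set D := delta `^ beta in nd invD *; set mx := Num.max 1 (s ^+ 4) in nd.
have D0 : 0 < D by rewrite powR_gt0.
have D32 : D <= 32^-1.
  have -> : 32^-1 = (32^-1 `^ beta^-1) `^ beta :> R.
    by rewrite -powRrM mulVf ?gt_eqF// powRr1// invr_ge0.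
  by rewrite ge0_ler_powR ?nnegrE ?powR_ge0 ?(ltW b0) ?(ltW d0).
have nn0 : 0 < n.+1%:R :> R by rewrite ltr0n.
have ndge1 : 1 <= n.+1%:R * delta by rewrite mulrC -ler_pdivrMr// div1r.
pose S := Num.truncn (n.+1%:R * delta).
have nd0 : 0 <= n.+1%:R * delta by lra.
have /andP[S1 S2] := truncn_itv nd0; rewrite -/S in S1 S2.
have S0 : (0 < S)%N by rewrite truncn_gt0.
have S0R : 1 <= S%:R :> R by rewrite ler1n.
have S00 : 0 < S%:R :> R by rewrite ltr0n.
have S3 : n.+1%:R * delta <= 2 * S%:R by move: S2; rewrite -natr1; lra.
have MS : ((M * S).*2 <= n)%N.
  rewrite -(ler_nat R) -muln2 !natrM.
  have h1 : M%:R * S%:R <= n.+1%:R / 4 :> R.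
    apply: (@le_trans _ _ (M%:R * (n.+1%:R * delta))); first by rewrite ler_wpM2l ?(ltW M0).
    rewrite mulrCA ler_wpM2l ?(ltW nn0)//.
    rewrite -ler_pdivlMl//; apply: le_trans dM _.
    by rewrite invfM mulrC.
  have : 2%:R <= n.+1%:R :> R by rewrite ler_nat.
  by move: h1; rewrite -natr1; lra.
pose V := 1 + s ^+ 2.
have V1 : 1 <= V by rewrite /V lerDl sqr_ge0.
have V0 : 0 < V by lra.
have mx0 : 0 < mx by rewrite lt_max ltr01.
have Vmx : V ^+ 2 <= 4 * mx.
  have s2 := sqr_ge0 s.
  have h1 : 1 <= mx by rewrite le_max lexx.
  have h2 : (s ^+ 2) ^+ 2 <= mx by rewrite -exprM le_max lexx orbT.
  rewrite /V; move: (s ^+ 2) s2 h2 => z z0 z2; nra.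
(* [l] minimizes the exponent [- l a + 2 l^2 V^2 / S]; with 16 in [a] the
   minimum is at most [- 4 ln n], which pays for the sum over the design. *)
pose a := 16 * D; pose l := S%:R * a / (4 * V ^+ 2).
have a0 : 0 < a by rewrite mulr_gt0.
have V20 : 0 < V ^+ 2 by rewrite exprn_gt0.
have l0 : 0 < l by rewrite divr_gt0// mulr_gt0.
have lS : l / S%:R * V <= 1 / 8.
  rewrite (_ : _ * _ = a / (4 * V)); last by rewrite /l; field; rewrite !lt0r_neq0.
  by rewrite ler_pdivrMr ?mulr_gt0// /a; lra.
have key : 4 * ln n.+1%:R <= S%:R * a ^+ 2 / (8 * V ^+ 2).
  rewrite ler_pdivlMr ?mulr_gt0//.
  have h1 : n.+1%:R * delta * D ^+ 2 <= 2 * S%:R * D ^+ 2 by rewrite ler_wpM2r ?sqr_ge0.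
  have h2 : V ^+ 2 * ln n.+1%:R <= 4 * mx * ln n.+1%:R by rewrite ler_wpM2r//; lra.
  rewrite nd in h1; rewrite /a exprMn; nra.
have ex : - l * a + 2 * l ^+ 2 * V ^+ 2 / S%:R = - (S%:R * a ^+ 2 / (8 * V ^+ 2)).
  by rewrite /l; field; rewrite !lt0r_neq0.
apply: le_trans (Hup n S s a l S0 MS s0 (ltW a0) l0 lS N) _.
rewrite -/V ex lee_fin -/W.
have expn : n.+1%:R * expR (- (S%:R * a ^+ 2 / (8 * V ^+ 2))) <= 1.
  apply: (@le_trans _ _ (n.+1%:R * expR (- ln n.+1%:R))).
    by rewrite ler_wpM2l ?(ltW nn0)// ler_expR lerN2; lra.
  by rewrite expRN lnK ?posrE// divff// gt_eqF.
have la : l^-1 <= a.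
  rewrite -div1r ler_pdivrMr//.
  have -> : a * l = 2 * (S%:R * a ^+ 2 / (8 * V ^+ 2)) by rewrite /l; field; rewrite !lt0r_neq0.
  lra.
have t1 : B * n.+1%:R^-1 `^ Num.min 1 beta <= B * D.
  rewrite ler_wpM2l//; case: (lerP 1 beta) => b1.
    by rewrite powRr1 ?invr_ge0.
  by rewrite ge0_ler_powR ?nnegrE ?invr_ge0 ?(ltW b0) ?(ltW d0).
have t2 : C * (S%:R / n.+1%:R) `^ beta <= C * D.
  rewrite ler_wpM2l// ge0_ler_powR ?nnegrE ?divr_ge0 ?(ltW b0) ?(ltW d0)//.
  by rewrite ler_pdivrMr// mulrC.
have t3 : l^-1 * (n.+1%:R * M%:R * 2 * expR (- (S%:R * a ^+ 2 / (8 * V ^+ 2)))) <= a * (2 * M%:R).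
  apply: ler_pM => //; first by rewrite invr_ge0 ltW.
  set e := expR _ in expn *.
  rewrite (_ : _ * e = (n.+1%:R * e) * (2 * M%:R)); last by ring.
  by rewrite ler_piMl// mulr_ge0// ltW.
apply: (@le_trans _ _ (B * D + (2 * h)^-1 * (C * D + W * (a + a * (2 * M%:R))))).
  apply: lerD => //; rewrite ler_wpM2l ?(ltW ih0)//; apply: lerD => //.
  by rewrite ler_wpM2l// lerD2l.
rewrite (_ : _ + _ = Cst * D); last by rewrite /Cst /a; ring.
by rewrite ler_wpM2r ?(ltW D0)//; lra.
Qed.

Lemma powR_nat_large (a C : R) : 0 < a ->
  exists M : nat, forall n, (M < n)%N -> C <= n%:R `^ a.
Proof.
move=> a0; exists (Num.truncn (`|C| `^ a^-1)) => n Mn.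
have c0 : 0 <= `|C| `^ a^-1 by exact: powR_ge0.
have /andP[_ t2] := truncn_itv c0.
have cn : `|C| `^ a^-1 <= n%:R by apply: le_trans (ltW t2) _; rewrite ler_nat.
apply: le_trans (ler_norm _) _.
have -> : `|C| = (`|C| `^ a^-1) `^ a.
  by rewrite -powRrM mulVf ?gt_eqF// powRr1.
by rewrite ge0_ler_powR ?nnegrE ?(ltW a0).
Qed.

Lemma ln_le_powR (a x : R) : 0 < a -> 0 < x -> ln x <= a^-1 * x `^ a.
Proof.
move=> a0 x0; rewrite ler_pdivlMl// -ln_powR.
have xa0 : 0 < x `^ a by rewrite powR_gt0.
have : ln (1 + (x `^ a - 1)) <= x `^ a - 1 by apply: le_ln1Dx; lra.
by rewrite (_ : 1 + (_ - 1) = x `^ a); [lra|ring].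
Qed.

(** [sigma^4] is eventually below [n ^ (1 - eta)] and the logarithm costs a
    further [n ^ (eta / 2)] at most, so that [r] tends to zero at a polynomial
    rate. *)
Lemma eventually_rate (beta eta eps : R) (sigma : nat -> R) :
  0 < beta -> 0 < eta < 1 -> 0 < eps ->
  sigma n ^+ 4 / n%:R `^ (1 - eta) @[n --> \oo] --> (0 : R) ->
  exists M : nat, forall n, (M < n)%N ->
    let r := Num.max 1 (sigma n ^+ 4) * (ln n%:R / n%:R) in
    [/\ (1 < n)%N, 1 <= ln n%:R :> R, n%:R^-1 <= r <= 1, r * n%:R `^ (eta / 2) <= 1 &
      r `^ (2 * beta + 1)^-1 <= eps].
Proof.
move=> b0 /andP[e0 e1] eps0 /cvgrPdist_le/(_ 1 ltr01)[M1 _ HM1].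
have e40 : 0 < eta / 4 by lra.
have e20 : 0 < eta / 2 by lra.
have q0 : 0 < 2 * beta + 1 by lra.
have [M2 HM2] := powR_nat_large (eta / 4)^-1 e40.
have [M3 HM3] := powR_nat_large (Num.max 1 (eps `^ (2 * beta + 1))^-1) e20.
have [M4 HM4] := powR_nat_large (expR 1) (ltr01 : 0 < (1 : R)).
exists (maxn 1 (maxn M1 (maxn M2 (maxn M3 M4)))) => n.
rewrite !gtn_max => /and5P[n1 /ltnW nM1 nM2 nM3 nM4] r.
have n0 : 0 < n%:R :> R by rewrite ltr0n ltnW.
have nN0 : n%:R != 0 :> R by rewrite gt_eqF.
have ln1 : 1 <= ln n%:R :> R.
  rewrite -[leLHS]expRK ler_ln ?posrE ?expR_gt0//.
  by have := HM4 n nM4; rewrite powRr1// ltW.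
have lnle : ln n%:R <= n%:R `^ (eta / 2).
  apply: le_trans (ln_le_powR e40 n0) _.
  rewrite (_ : eta / 2 = eta / 4 + eta / 4); last by field.
  rewrite powRD ?nN0 ?implybT// ler_wpM2r ?powR_ge0//.
  exact: HM2.
have pe0 : 0 < n%:R `^ (1 - eta) by rewrite powR_gt0.
have mxle : Num.max 1 (sigma n ^+ 4) <= n%:R `^ (1 - eta).
  rewrite ge_max; apply/andP; split.
    rewrite [leLHS](_ : _ = 1 `^ (1 - eta)); last by rewrite powR1.
    by rewrite ge0_ler_powR ?nnegrE ?subr_ge0 ?(ltW e1) ?(ltW n0)// ler1n ltnW.
  have := HM1 n nM1; rewrite /= sub0r normrN => /ler_normlW.
  by rewrite ler_pdivrMr// mul1r.
have mx1 : 1 <= Num.max 1 (sigma n ^+ 4) by rewrite le_max lexx.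
have rge : n%:R^-1 <= r.
  rewrite /r mulrA ler_pdivlMr// mulVf//.
  by rewrite -[leLHS]mulr1 ler_pM.
have rle : r * n%:R `^ (eta / 2) <= 1.
  apply: (@le_trans _ _ (n%:R `^ (1 - eta) * (n%:R `^ (eta / 2) / n%:R) * n%:R `^ (eta / 2))).
    rewrite ler_wpM2r ?powR_ge0// ler_pM//; first by lra.
      by rewrite divr_ge0//; lra.
    by rewrite ler_wpM2r// invr_ge0 ltW.
  rewrite (_ : _ * _ = n%:R `^ (1 - eta) * n%:R `^ (eta / 2) * n%:R `^ (eta / 2) / n%:R); last by ring.
  rewrite -!powRD ?nN0 ?implybT// (_ : 1 - eta + eta / 2 + eta / 2 = 1); last by field.
  by rewrite powRr1 ?(ltW n0)// divff.
have r0 : 0 <= r by apply: le_trans rge; rewrite invr_ge0 ltW.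
have := HM3 n nM3; rewrite ge_max => /andP[pn1 pneps].
have ep0 : 0 < eps `^ (2 * beta + 1) by rewrite powR_gt0.
have rp p : 0 < p -> p^-1 <= n%:R `^ (eta / 2) -> r <= p.
  move=> p0 pn; rewrite -[leRHS]mul1r -ler_pdivrMr//; apply: le_trans rle.
  exact: ler_wpM2l.
split => //.
  by rewrite rge/=; apply: rp => //; rewrite invr1.
have -> : eps = (eps `^ (2 * beta + 1)) `^ (2 * beta + 1)^-1.
  by rewrite -powRrM mulfV ?gt_eqF// powRr1// ltW.
by rewrite ge0_ler_powR ?nnegrE ?invr_ge0 ?powR_ge0 ?(ltW q0)//; exact: rp.
Qed.

End rates.

Theorem theorem2p2 (R : realType) (beta L h eta : R) :
  0 < beta -> 0 < L -> 0 < h < 1 -> 0 < eta < 1 ->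
  exists C C' : R, [/\ 0 < C, 0 < C' &
    forall sigma : nat -> R,
      (forall n, (0 < n)%N -> 0 <= sigma n) ->
      sigma n ^+ 4 / n%:R `^ (1 - eta) @[n --> \oo] --> (0 : R) ->
      forall N : forall n, noise_model n (sigma n),
      Theta_with C C'
        (fun n => minimax_risk (bounded_holder_class h beta L) (N n))
        (fun n => ((Num.max 1 (sigma n ^+ 4) * (ln n%:R / n%:R))
                     `^ (beta / (2 * beta + 1)))%:E)].
Proof.
move=> b0 L0 h01 eta01.
have /andP[h0 h1] := h01; have /andP[e0 e1] := eta01.
have [Cu [eps [Cu0 eps0 Hup]]] := minimax_risk_upper_rate b0 L0 h0.
have [K K0 Hlow] := minimax_risk_lower b0 L0 h01.
set p := (smoothness_order beta).+1 in Hlow.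
have q0 : 0 < 2 * beta + 1 by lra.
(* The bandwidth is at most [n ^ (- 2 theta)], so that eventually there are at
   least [n ^ theta] disjoint bumps. *)
pose theta := eta / (4 * (2 * beta + 1)).
have th0 : 0 < theta by rewrite divr_gt0// mulr_gt0.
(* The last bound keeps the second moment of the likelihood ratios,
   [n ^ (8 kappa^2 / h^4)], below [n ^ theta]. *)
pose kappa := Num.min K (Num.min (1 - h) (Num.min (h ^+ 2 / 4)
  (h ^+ 2 * Num.sqrt (theta / 8)))).
have k0 : 0 < kappa.
  rewrite !lt_min K0 subr_gt0 h1 divr_gt0 ?exprn_gt0//=.
  by rewrite mulr_gt0 ?exprn_gt0// sqrtr_gt0 divr_gt0.
have kK : kappa <= K by rewrite ge_min lexx.
have k1h : kappa <= 1 - h by rewrite !ge_min lexx orbT.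
have kh2 : kappa <= h ^+ 2 / 4 by rewrite !ge_min lexx !orbT.
have kth : 8 * kappa ^+ 2 / h ^+ 4 <= theta.
  have ks : kappa <= h ^+ 2 * Num.sqrt (theta / 8) by rewrite !ge_min lexx !orbT.
  rewrite ler_pdivrMr ?exprn_gt0//.
  have : kappa ^+ 2 <= (h ^+ 2 * Num.sqrt (theta / 8)) ^+ 2.
    by rewrite lerXn2r// nnegrE ltW// (lt_le_trans k0).
  rewrite exprMn sqr_sqrtr; last by rewrite divr_ge0// ltW.
  rewrite -exprM => H.
  by have -> : theta * h ^+ 4 = 8 * (h ^+ 4 * (theta / 8)) by [field]; rewrite ler_wpM2l.
have bh0 : 0 < bump_height p :> R by rewrite exprn_gt0 ?invr_gt0.
pose c := kappa * bump_height p / 16.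
have c0 : 0 < c by rewrite divr_gt0// mulr_gt0.
exists Cu, c^-1; split => //; first by rewrite invr_gt0.
move=> sigma sigma0 sigmalim N.
have eps10 : 0 < Num.min 1 eps by rewrite lt_min ltr01.
have [M1 HM1] := eventually_rate b0 eta01 eps10 sigmalim.
have [M2 HM2] := powR_nat_large 2 th0.
have main n : (maxn M1 M2 < n)%N -> exists delta : R,
    [/\ (Num.max 1 (sigma n ^+ 4) * (ln n%:R / n%:R)) `^ (beta / (2 * beta + 1)) = delta `^ beta,
      (minimax_risk (bounded_holder_class h beta L) (N n) <= (Cu * delta `^ beta)%:E)%E &
      ((c * delta `^ beta)%:E <= minimax_risk (bounded_holder_class h beta L) (N n))%E].
  rewrite gtn_max => /andP[nM1 nM2].
  have [n1 ln1 /andP[rge rle] reta rdelta] := HM1 n nM1.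
  set r := Num.max 1 _ * _ in rge rle reta rdelta *.
  have n0 : 0 < n%:R :> R by rewrite ltr0n ltnW.
  have r0 : 0 < r by apply: lt_le_trans rge; rewrite invr_gt0.
  pose delta := r `^ (2 * beta + 1)^-1; exists delta.
  move: rdelta; rewrite -/delta le_min => /andP[d1 deps].
  have d0 : 0 < delta by rewrite powR_gt0.
  have s0 : 0 <= sigma n by apply: sigma0; exact: ltnW.
  have rateE : r `^ (beta / (2 * beta + 1)) = delta `^ beta.
    by rewrite /delta -powRrM mulrC.
  have dr : delta * (delta `^ beta) ^+ 2 = r.
    rewrite -powR_mulrn ?powR_ge0// -powRrM -[X in X * _](powRr1 (ltW d0)).
    rewrite -powRD ?(gt_eqF d0) ?implybT// /delta -powRrM.
    by rewrite (_ : _ * _ = 1) ?powRr1 ?(ltW r0)//; field; exact: lt0r_neq0.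
  have nd : n%:R * delta * (delta `^ beta) ^+ 2 = Num.max 1 (sigma n ^+ 4) * ln n%:R.
    by rewrite -mulrA dr /r; field; exact: lt0r_neq0.
  have rpow a : a <= 1 -> r <= r `^ a.
    by move=> a1; apply: ger1_powR => //; rewrite r0.
  have invd : n%:R^-1 <= delta.
    by apply: le_trans rge _; apply: rpow; rewrite invf_le1//; lra.
  have invD : n%:R^-1 <= delta `^ beta.
    apply: le_trans rge _; rewrite -rateE; apply: rpow.
    by rewrite ler_pdivrMr// mul1r; lra.
  split => //.
    by apply: Hup => //; rewrite d0.
  apply: Hlow => //; first exact: ltnW.
  - by rewrite d0.
  - by rewrite -ler_pdivrMl// mulr1.
  rewrite nd [_ * ln _ / _]mulrAC divff ?mul1r; last by rewrite gt_eqF// lt_max ltr01.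
  have nth : 2 <= n%:R `^ theta by exact: HM2.
  apply: (@le_trans _ _ (n%:R `^ theta)).
    rewrite /powR gt_eqF// ler_expR ler_wpM2r//; lra.
  have di : n%:R `^ theta * n%:R `^ theta <= delta^-1.
    rewrite -[leRHS]mul1r ler_pdivlMr// -powRD ?(gt_eqF n0) ?implybT//.
    rewrite (_ : theta + theta = eta / 2 * (2 * beta + 1)^-1); last first.
      by rewrite /theta; field; exact: lt0r_neq0.
    rewrite powRrM /delta -powRM ?powR_ge0 ?(ltW r0)//.
    by rewrite powR_le1 ?invr_ge0 ?(ltW q0)// mulr_ge0 ?powR_ge0 ?(ltW r0)//= mulrC.
  have di0 : 0 <= delta^-1 by rewrite invr_ge0 ltW.
  have /andP[_] := truncn_itv di0; rewrite -natr1; nra.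
split.
  exists (maxn M1 M2) => n /main[delta [-> up low]].
  rewrite abse_EFin ger0_norm ?powR_ge0// -EFinM gee0_abs//.
  by apply: le_trans low; rewrite lee_fin mulr_ge0 ?powR_ge0// ltW.
exists (maxn M1 M2) => n /main[delta [-> up low]].
rewrite abse_EFin ger0_norm ?powR_ge0// gee0_abs; last first.
  by apply: le_trans low; rewrite lee_fin mulr_ge0 ?powR_ge0// ltW.
by rewrite lee_pdivlMl// -EFinM.
Qed.
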